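(* Let $m>4$ be an integer, let $B^m\subset\mathbb{R}^m$ be the unit ball, and let $v=(v_{ijk})_{1\le i,j,k\le m}\colon B^m\to\mathbb{S}^{m^3-1}\subset\mathbb{R}^{m^3}$ be the map $$v_{ijk}(x)=\frac{1}{\sqrt{(m-1)(m+2)}}\Big(\delta_{ij}\frac{x_k}{r}+\delta_{jk}\frac{x_i}{r}+\delta_{ik}\frac{x_j}{r}-(m+2)\frac{x_ix_jx_k}{r^3}\Big),\qquad r=|x|.$$ Let $\beta\in(0,\frac{\pi}{2})$. Then the map $$\tilde v\colon B^m\to\mathbb{S}^{m^3}\subset\mathbb{R}^{m^3}\times\mathbb{R},\qquad x\mapsto\big(\sin\beta\;v(x),\cos\beta\big)$$ is a proper (weak) biharmonic map if and only if $$\sin^2\beta=\frac{5}{6}\,\frac{m-1}{m+1}.$$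
   Context: Maps are defined almost everywhere (here, for $x\neq0$); $\delta_{ij}$ is the Kronecker delta, $r=\sqrt{x_1^2+\dots+x_m^2}$, and $\Delta$ is the Euclidean Laplacian ($\Delta=\sum_k\partial_k^2$), acting componentwise. $W^{2,2}(B^m,\mathbb{S}^n)$ is the set of $w\in W^{2,2}(B^m,\mathbb{R}^{n+1})$ with $w(x)\in\mathbb{S}^n$ for a.e. $x$, where $\mathbb{S}^n\subset\mathbb{R}^{n+1}$ is the unit sphere. A map $w\in W^{2,2}(B^m,\mathbb{S}^n)$ is a weak biharmonic map if it solves $$\Delta^2w+2\operatorname{div}(|\nabla w|^2\nabla w)+\big(|\Delta w|^2+\Delta|\nabla w|^2+2\langle\nabla w,\nabla\Delta w\rangle+2|\nabla w|^4\big)w=0$$ in the sense of distributions on $B^m$, i.e. for every $\varphi\in C_c^\infty(B^m,\mathbb{R}^{n+1})$ $$\int_{B^m}\Big(\langle\Delta w,\Delta\varphi\rangle-2|\nabla w|^2\langle\nabla w,\nabla\varphi\rangle+(|\Delta w|^2+2|\nabla w|^4)\langle w,\varphi\rangle+|\nabla w|^2\Delta\langle w,\varphi\rangle-2|\Delta w|^2\langle w,\varphi\rangle-2\sum_k\langle\Delta w,\partial_kw\rangle\,\partial_k\langle w,\varphi\rangle\Big)dx=0.$$ Here $|\nabla w|^2=\sum_k|\partial_kw|^2$. The equation is the Euler–Lagrange equation of the bienergy $E_2(w)=\frac12\int_{B^m}(|\Delta w|^2-|\nabla w|^4)\,dx$. A weak biharmonic map is proper if it is not (weakly) harmonic, i.e.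 if it does not solve $\Delta w+|\nabla w|^2w=0$ in the sense of distributions. *)

(* Defs.v *)
From HB Require Import structures.
From mathcomp Require Import all_boot all_order all_algebra.
From mathcomp Require Import all_classical all_reals all_analysis.

Set Implicit Arguments.
Unset Strict Implicit.
Unset Printing Implicit Defensive.

Import Order.TTheory GRing.Theory Num.Theory.
Import numFieldNormedType.Exports.

Local Open Scope classical_set_scope.
Local Open Scope ring_scope.

(* Borel sets of R^n: the product sigma-algebra, generated by the coordinates. *)
Definition rV_display : measure_display. Proof. exact. Qed.

Section rV_measurable.
Context {R : realType} {n : nat}.

Definition rV_measurable : set (set 'rV[R]_n) :=
  <<s [set A : set 'rV[R]_n | exists (i : 'I_n) (Y : set R),
                 measurable Y /\ A = [set x : 'rV[R]_n | Y (x ord0 i)]] >>.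

Let rV_measurable0 : rV_measurable set0.
Proof. exact: sigma_algebra0. Qed.

Let rV_measurableC A : rV_measurable A -> rV_measurable (~` A).
Proof. exact: sigma_algebraC. Qed.

Let rV_measurable_bigcup (F : (set 'rV[R]_n)^nat) :
  (forall i, rV_measurable (F i)) -> rV_measurable (\bigcup_i (F i)).
Proof. exact: sigma_algebra_bigcup. Qed.

HB.instance Definition _ := @isMeasurable.Build rV_display 'rV[R]_n
  rV_measurable rV_measurable0 rV_measurableC rV_measurable_bigcup.

End rV_measurable.

Section rV_measurable_fun.
Context {R : realType}.

Lemma measurable_rV_coord n (i : 'I_n) :
  measurable_fun setT (fun x : 'rV[R]_n => x ord0 i).
Proof.
by move=> _ Y mY; rewrite setTI; apply: sub_sigma_algebra; exists i, Y.
Qed.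

Lemma measurable_fun_rV d (T : measurableType d) n (f : T -> 'rV[R]_n) :
  (forall i, measurable_fun setT (fun t => f t ord0 i)) ->
  measurable_fun setT f.
Proof.
move=> mf; apply: (@measurability _ _ _ _ setT f _ (erefl rV_measurable)).
move=> _ [_ [i [Y [mY ->]]] <-].
exact: (mf i measurableT Y mY).
Qed.

Definition rV_cons n (p : R * 'rV[R]_n) : 'rV[R]_n.+1 :=
  \row_i (if unlift ord0 i is Some j then p.2 ord0 j else p.1).

Definition rV_uncons n (x : 'rV[R]_n.+1) : R * 'rV[R]_n :=
  (x ord0 ord0, \row_j x ord0 (lift ord0 j)).

Lemma rV_uncons_consK n : cancel (@rV_cons n) (@rV_uncons n).
Proof.
case=> a t; rewrite /rV_uncons mxE unlift_none; congr (_, _).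
by apply/rowP => j; rewrite !mxE liftK.
Qed.

Lemma measurable_rV_cons n : measurable_fun setT (@rV_cons n).
Proof.
apply: measurable_fun_rV => i; under eq_fun do rewrite mxE.
case: (unlift ord0 i) => [j|]; last exact: measurable_fst.
exact: (measurableT_comp (measurable_rV_coord j) measurable_snd).
Qed.

Lemma measurable_rV_uncons n : measurable_fun setT (@rV_uncons n).
Proof.
apply/measurable_fun_pairP; split; first exact: measurable_rV_coord.
apply: measurable_fun_rV => j.
by under eq_fun do rewrite mxE; exact: measurable_rV_coord.
Qed.

End rV_measurable_fun.

Section lebesgue_cons.
Context {R : realType} {n : nat}.
Variable mu : {sigma_finite_measure set 'rV[R]_n -> \bar R}.

Definition lebesgue_cons : set 'rV[R]_n.+1 -> \bar R :=
  pushforward (@lebesgue_measure R \x mu)%E (@rV_cons R n).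

HB.instance Definition _ :=
  Measure.copy lebesgue_cons
    (measure_function_pushforward__canonical__measure_function_Measure
      (@lebesgue_measure R \x mu)%E (@measurable_rV_cons R n)).

Let lebesgue_cons_sigma_finite : sigma_finite setT lebesgue_cons.
Proof.
have /sigma_finiteP[F [TF ndF Foo]] := sigma_finiteT (@lebesgue_measure R).
have /sigma_finiteP[G [TG ndG Goo]] := sigma_finiteT mu.
exists (fun i => @rV_uncons R n @^-1` (F i `*` G i)).
  rewrite -preimage_bigcup (_ : \bigcup_i _ = setT) ?preimage_setT//.
  apply/seteqP; split=> // -[x y] _.
  have [i _ Fix] : (\bigcup_i F i) x by rewrite -TF.
  have [j _ Gjy] : (\bigcup_i G i) y by rewrite -TG.
  exists (maxn i j) => //; split.
  - by move: x Fix; exact/subsetPset/ndF/leq_maxl.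
  - by move: y Gjy; exact/subsetPset/ndG/leq_maxr.
move=> i; have [mFi Fioo] := Foo i; have [mGi Gioo] := Goo i; split.
  rewrite -[X in measurable X]setTI; apply: measurable_rV_uncons => //.
  exact: measurableX.
rewrite /lebesgue_cons /pushforward -comp_preimage.
rewrite (_ : _ \o _ = id) ?preimage_id; last first.
  by apply/funext => p /=; rewrite rV_uncons_consK.
rewrite product_measure1E// lte_mul_pinfty// ge0_fin_numE//.
Qed.

HB.instance Definition _ :=
  Measure_isSigmaFinite.Build _ _ _ lebesgue_cons lebesgue_cons_sigma_finite.

End lebesgue_cons.

Section lebesgue_rV.
Context {R : realType}.

(* Lebesgue measure on R^n: Dirac mass on the one-point space R^0, then
   one-dimensional Lebesgue measure times Lebesgue measure on R^n. *)
Fixpoint lebesgue_rV (n : nat) : {sigma_finite_measure set 'rV[R]_n -> \bar R} :=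
  match n with
  | 0 => [the {sigma_finite_measure set _ -> \bar R} of \d_(0 : 'rV[R]_0)]
  | n'.+1 => [the {sigma_finite_measure set _ -> \bar R} of
               lebesgue_cons (lebesgue_rV n')]
  end.

Lemma lebesgue_rV_box n (A : 'I_n -> set R) :
  (forall i, measurable (A i)) ->
  lebesgue_rV n [set x : 'rV[R]_n | forall i, A i (x ord0 i)] =
  (\prod_(i < n) @lebesgue_measure R (A i))%E.
Proof.
elim: n A => [|n IHn] A mA.
  by rewrite big_ord0 /= diracE mem_set//= => -[].
rewrite big_ord_recl /= -IHn//.
set B := [set x : 'rV[R]_n | _].
have mB : measurable B.
  rewrite (_ : B = \bigcap_(i : 'I_n)
      (fun x : 'rV[R]_n => x ord0 i) @^-1` A (lift ord0 i)); last first.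
    by apply/seteqP; split => x /= h i; [move=> _|]; exact: h.
  apply: fin_bigcap_measurable => // i _.
  by rewrite -[X in measurable X]setTI; exact: measurable_rV_coord.
rewrite -[RHS](product_measure1E lebesgue_measure (lebesgue_rV n) (mA ord0) mB).
congr (product_measure1 _ _ _); apply/seteqP; split=> -[a x] /=.
  move=> h; split; first by have := h ord0; rewrite mxE unlift_none.
  by move=> i; have := h (lift ord0 i); rewrite mxE liftK.
by move=> [h0 h] i; rewrite mxE; case: unliftP => [j|] ->.
Qed.

End lebesgue_rV.

Section weak_derivatives.
Context {R : realType} {m : nat}.
Implicit Types (f g phi : 'rV[R]_m -> R).

Local Notation mu := (@lebesgue_rV R m).

(* The library norm on 'rV[R]_m is the sup norm. *)
Definition euclid (x : 'rV[R]_m) : R := Num.sqrt (\sum_i x ord0 i ^+ 2).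

Definition unit_ball : set 'rV[R]_m := [set x | euclid x < 1].

Definition partial (k : 'I_m) f : 'rV[R]_m -> R :=
  fun x => 'D_(delta_mx ord0 k) f x.

Definition laplacian f : 'rV[R]_m -> R :=
  fun x => \sum_k partial k (partial k f) x.

Definition smooth f := forall (s : seq 'I_m) x,
  differentiable (foldr partial f s) x.

(* C_c^infty(B^m), as functions on R^m supported in B^m. *)
Definition test_function phi :=
  [/\ smooth phi,
      compact (closure [set x | phi x != 0]) &
      closure [set x | phi x != 0] `<=` unit_ball].

Definition loc_integrable f := forall K : set 'rV[R]_m,
  compact K -> K `<=` unit_ball -> mu.-integrable K (EFin \o f).

Definition is_weak_partial (k : 'I_m) f g :=
  [/\ loc_integrable f, loc_integrable g &
      forall phi, test_function phi ->
        \int[mu]_(x in unit_ball) (f x * partial k phi x) =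
        - \int[mu]_(x in unit_ball) (g x * phi x)].

(* Some weak k-th partial derivative of f on B^m, unique up to a null set
   when there is one; 0 when there is none. *)
Definition wpartial (k : 'I_m) f : 'rV[R]_m -> R :=
  xget (fun=> 0) [set g | is_weak_partial k f g].

Definition wlaplacian f : 'rV[R]_m -> R :=
  fun x => \sum_k wpartial k (wpartial k f) x.

Definition L2 f :=
  measurable_fun unit_ball f /\
  mu.-integrable unit_ball (fun x => (f x ^+ 2)%:E).

Definition W12 f :=
  L2 f /\ forall k, is_weak_partial k f (wpartial k f) /\ L2 (wpartial k f).

Definition W22 f := W12 f /\ forall k, W12 (wpartial k f).

End weak_derivatives.

(* Maps into the Euclidean space R^I are families of component functions. *)
Section maps.
Context {R : realType} {m : nat} {I : finType}.
Implicit Types u w phi : I -> 'rV[R]_m -> R.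

Local Notation mu := (@lebesgue_rV R m).

Definition inner u w : 'rV[R]_m -> R := fun x => \sum_a u a x * w a x.

Definition Dk (k : 'I_m) w : I -> 'rV[R]_m -> R := fun a => wpartial k (w a).

Definition Lap w : I -> 'rV[R]_m -> R := fun a => wlaplacian (w a).

Definition grad_sq w : 'rV[R]_m -> R :=
  fun x => \sum_k inner (Dk k w) (Dk k w) x.

Definition W22_sphere w :=
  (forall a, W22 (w a)) /\
  {ae mu, forall x, unit_ball x -> \sum_a w a x ^+ 2 = 1}.

(* Derivatives of test maps are classical; those of w and of <w, phi> are
   weak. *)
Definition biharmonic_integrand w phi : 'rV[R]_m -> R := fun x =>
  inner (Lap w) (fun a => laplacian (phi a)) x
  - 2 * grad_sq w x * (\sum_k inner (Dk k w) (fun a => partial k (phi a)) x)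
  + (inner (Lap w) (Lap w) x + 2 * grad_sq w x ^+ 2) * inner w phi x
  + grad_sq w x * wlaplacian (inner w phi) x
  - 2 * inner (Lap w) (Lap w) x * inner w phi x
  - 2 * (\sum_k inner (Lap w) (Dk k w) x * wpartial k (inner w phi) x).

Definition weakly_biharmonic w :=
  W22_sphere w /\
  forall phi, (forall a, test_function (phi a)) ->
    \int[mu]_(x in unit_ball) biharmonic_integrand w phi x = 0.

Definition weakly_harmonic w :=
  (forall a, W12 (w a)) /\
  forall phi, (forall a, test_function (phi a)) ->
    \int[mu]_(x in unit_ball)
      (inner w (fun a => laplacian (phi a)) x
       + grad_sq w x * inner w phi x) = 0.

Definition proper_weakly_biharmonic w :=
  weakly_biharmonic w /\ ~ weakly_harmonic w.

End maps.

Section the_map.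
Context {R : realType} {m : nat}.

(* R^(m^3) has coordinates indexed by triples (i, j, k), and
   R^(m^3) x R by the disjoint union of the triples and a point. *)
Definition vmap (a : 'I_m * 'I_m * 'I_m) (x : 'rV[R]_m) : R :=
  let: (i, j, k) := a in
  let r := euclid x in
  (Num.sqrt ((m%:R - 1) * (m%:R + 2)))^-1 *
  ((i == j)%:R * (x ord0 k / r) + (j == k)%:R * (x ord0 i / r)
   + (i == k)%:R * (x ord0 j / r)
   - (m%:R + 2) * (x ord0 i * x ord0 j * x ord0 k / r ^+ 3)).

Definition vtilde (beta : R) (a : 'I_m * 'I_m * 'I_m + unit) (x : 'rV[R]_m) : R :=
  match a with
  | inl b => sin beta * vmap b x
  | inr _ => cos beta
  end.

End the_map.

(* Main.v *)
Require Import Defs.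
From HB Require Import structures.
From mathcomp Require Import all_boot all_order all_algebra.
From mathcomp Require Import all_classical all_reals all_analysis.
From mathcomp Require Import measurable_realfun.
From mathcomp Require Import ring lra.

(** With [r = |x|], [q = 1/r] and [lam = 3 (m + 1)], every component of [v] is
a cubic polynomial in the [x_i / r] which satisfies [Delta v = - lam q^2 v] off
the origin and has no radial derivative; together with [|v| = 1] this gives
[|grad v|^2 = lam q^2] and [Delta (q^2 v) = - (lam + 2 (m - 4)) q^4 v].  All the
functions that occur are smooth off the origin and [O(r^-n)] with [n <= 4] near
it, hence integrable for [m >= 5], and integration by parts across the origin
is justified by a rational cutoff.  Writing [s = sin beta], [c = cos beta], the
weak equation tested against [phi] becomes
  [lam s E * int q^4 (c^2 <v, phi> - c s phi_last) = 0],
with [E = lam + 2 (m - 4) - 2 s^2 lam], so it holds for all [phi] if and only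
if [E = 0].  Because the weak derivatives in the statement are arbitrarily
chosen representatives, the computation also rests on the du Bois-Reymond
lemma, which is obtained from products of one-dimensional bumps approximating
indicators of boxes. *)

Set Implicit Arguments.
Unset Strict Implicit.
Unset Printing Implicit Defensive.

Import Order.TTheory GRing.Theory Num.Theory.
Import numFieldNormedType.Exports.

Local Open Scope classical_set_scope.
Local Open Scope ring_scope.

(** * Borel sets and boxes *)

Section borel_rV.
Context {R : realType} {n : nat}.
Implicit Types (a b : 'I_n -> R) (U K : set 'rV[R]_n).
Local Notation mu := (@lebesgue_rV R n).

(** The exponent 4 leaves no slack: for m = 5 the power r^-n with n an integer is integrable at the
    origin exactly when n <= 4, and both the squares of second derivatives of the map and the result
    of moving two derivatives from phi onto q^2 v are of size r^-4. Each integration by parts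
    therefore involves a product of size r^-3 whose derivative has size r^-4. The cutoff is a cube
    so that it vanishes to order 6: multiplied by an O(r^-3) function it leaves O(r^3), with
    derivative O(r^2), hence a function that the divergence theorem accepts across the origin, while
    its own gradient costs only one factor 1/r uniformly in e. In the weak equation the terms with
    grad phi cancel pointwise, and the remaining Laplacians of phi carry the factors q^2 v and q^2,
    to which Green's identity applies. The number in the theorem comes from lam + 2 (m - 4) = 5 (m -
    1) and 2 lam = 6 (m + 1), which give E = 5 (m - 1) - 6 (m + 1) s^2. Test maps with only the last
    component nonzero suffice to detect E and also to refute harmonicity, because s, c and lam do
    not vanish. *)

Definition obox a b : set 'rV[R]_n :=
  [set x | forall i, x ord0 i \in `]a i, b i[].

Definition cbox a b : set 'rV[R]_n :=
  [set x | forall i, x ord0 i \in `[a i, b i]].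

Lemma sub_obox_cbox a b : obox a b `<=` cbox a b.
Proof. by move=> x h i; apply: subset_itv_oo_cc; exact: h. Qed.

Lemma measurable_coord_forall (A : 'I_n -> set R) :
  (forall i, measurable (A i)) ->
  measurable [set x : 'rV[R]_n | forall i, A i (x ord0 i)].
Proof.
move=> mA; rewrite (_ : mkset _ = \bigcap_(i : 'I_n)
    (fun x : 'rV[R]_n => x ord0 i) @^-1` A i); last first.
  by apply/seteqP; split => x /= h i; [move=> _|]; exact: h.
apply: fin_bigcap_measurable => // i _.
by rewrite -[X in measurable X]setTI; exact: measurable_rV_coord.
Qed.

Lemma measurable_obox a b : measurable (obox a b).
Proof. exact: (@measurable_coord_forall (fun i => [set` `]a i, b i[ ])). Qed.

Lemma measurable_cbox a b : measurable (cbox a b).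
Proof. exact: (@measurable_coord_forall (fun i => [set` `[a i, b i] ])). Qed.

Definition ratlo (p : 'I_n -> rat) (k : nat) (i : 'I_n) : R :=
  ratr (p i) - k.+1%:R^-1.
Definition rathi (p : 'I_n -> rat) (k : nat) (i : 'I_n) : R :=
  ratr (p i) + k.+1%:R^-1.

(** Cubes with rational centre and radius 1/(k+1) form a countable family. Keeping the closed cube
    inside U serves twice: for Borel measurability of open sets, and for covering the ball by boxes
    whose closures are compact subsets of it. *)
Lemma open_ratbox U x : open U -> U x -> exists (p : {ffun 'I_n -> rat}) k,
  obox (ratlo p k) (rathi p k) x /\ cbox (ratlo p k) (rathi p k) `<=` U.
Proof.
move=> oU Ux; have /nbhs_ballP[e /= e0 eU] : nbhs x U by exact: open_nbhs_nbhs.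
(* Half of e: two points of the cube are each within 1/(k+1) of its centre, so less than e apart in
   the sup norm. *)
have [k _ /(_ k (leqnn _))/= ke] := near_infty_natSinv_lt (PosNum (divr_gt0 e0 (ltr0Sn _ 1))).
have k0 : 0 < k.+1%:R^-1 :> R by rewrite invr_gt0.
have /fin_all_exists[p px] (i : 'I_n) : exists q : rat,
    ratr q \in `]x ord0 i - k.+1%:R^-1, x ord0 i + k.+1%:R^-1[.
  by apply: rat_in_itvoo; rewrite ltrBlDr -addrA ltrDl addr_gt0.
exists [ffun i => p i], k; split => [i|y yp].
  by have := px i; rewrite /ratlo /rathi ffunE !in_itv/=; set d := _^-1 => /andP[? ?];
    apply/andP; split; lra.
apply: eU; split => // i j; rewrite (ord1 i); move: ke.
have := yp j; have := px j; rewrite /ratlo /rathi ffunE !in_itv/=;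
  set d := _^-1 => /andP[? ?] /andP[? ?] ?.
by rewrite /ball/= ltr_norml; apply/andP; split; lra.
Qed.

Lemma measurable_open U : open U -> measurable U.
Proof.
move=> oU; rewrite (_ : U = \bigcup_(q in [set q : {ffun 'I_n -> rat} * nat |
    cbox (ratlo q.1 q.2) (rathi q.1 q.2) `<=` U]) obox (ratlo q.1 q.2) (rathi q.1 q.2)).
  rewrite bigcup_mkcond; apply: countable_bigcupT_measurable; first exact: countableP.
  by move=> q; case: ifP => // _; exact: measurable_obox.
apply/seteqP; split => [x Ux|x [q qU]]; last by move/sub_obox_cbox/qU.
by have [p [k [? ?]]] := open_ratbox oU Ux; exists (p, k).
Qed.


Lemma measurable_compact K : compact K -> measurable K.
Proof.
move=> /(compact_closed (@norm_hausdorff _ _)) cK; rewrite -[K]setCK.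
by apply: measurableC; apply: measurable_open; exact: closed_openC.
Qed.

Lemma measurable_fun_rV_continuous (f : 'rV[R]_n -> R) :
  continuous f -> measurable_fun setT f.
Proof.
move=> /continuousP cf; apply: (measurability _ (RGenOpens.measurableE R)).
move=> _ [_ [a [b ->] <-]]; rewrite setTI; apply: measurable_open; apply: cf.
exact: interval_open.
Qed.

Lemma lebesgue_obox a b : (forall i, a i <= b i) ->
  mu (obox a b) = (\prod_(i < n) (b i - a i))%:E.
Proof.
move=> ab; rewrite (_ : obox a b = [set x | forall i, [set` `]a i, b i[ ] (x ord0 i)])//.
rewrite (@lebesgue_rV_box R n (fun i => [set` `]a i, b i[ ]))// -prodEFin; apply: eq_bigr => i _.
rewrite lebesgue_measure_itv/= lte_fin; case: ltP => // ba.
by congr EFin; have := ab i; lra.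
Qed.

Lemma lebesgue_cbox a b : (forall i, a i <= b i) ->
  mu (cbox a b) = (\prod_(i < n) (b i - a i))%:E.
Proof.
move=> ab; rewrite (_ : cbox a b = [set x | forall i, [set` `[a i, b i] ] (x ord0 i)])//.
rewrite (@lebesgue_rV_box R n (fun i => [set` `[a i, b i] ]))// -prodEFin; apply: eq_bigr => i _.
rewrite lebesgue_measure_itv/= lte_fin; case: ltP => // ba.
by congr EFin; have := ab i; lra.
Qed.

Lemma abs_coord_le_euclid (x : 'rV[R]_n) i : `|x ord0 i| <= euclid x.
Proof.
rewrite -sqrtr_sqr ler_wsqrtr// (bigD1 i)//= lerDl sumr_ge0// => j _.
exact: sqr_ge0.
Qed.

Lemma euclid_eq0 (x : 'rV[R]_n) : (euclid x == 0) = (x == 0).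
Proof.
apply/eqP/eqP => [x0|->]; last first.
  by rewrite /euclid big1 ?sqrtr0// => i _; rewrite mxE expr0n.
apply/rowP => i; apply/eqP; rewrite mxE -normr_eq0 eq_le normr_ge0 andbT.
by rewrite -x0 abs_coord_le_euclid.
Qed.

Lemma euclid_gt0 (x : 'rV[R]_n) : (0 < euclid x) = (x != 0).
Proof. by rewrite -euclid_eq0 lt_def sqrtr_ge0 andbT. Qed.

Lemma continuous_coord i : continuous (fun x : 'rV[R]_n => x ord0 i).
Proof. by move=> x; exact/differentiable_continuous/differentiable_coord. Qed.

Lemma continuous_euclid : continuous (@euclid R n).
Proof.
move=> x; apply: (@continuous_comp _ _ _ (fun x : 'rV[R]_n => \sum_i x ord0 i ^+ 2)).
  apply: (@continuous_big R _ +%R 0 xpredT _ _ _ _); first exact: add_continuous.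
  move=> i _ y; apply: (@continuous_comp _ _ _ _ (fun t : R => t ^+ 2)).
    exact: continuous_coord.
  exact: exprn_continuous.
exact: sqrt_continuous.
Qed.

Lemma open_unit_ball : open (@unit_ball R n).
Proof.
by move: continuous_euclid => /continuousP/(_ `]-oo, 1[%classic)/(_ (interval_open _ _)); exact.
Qed.

Lemma measurable_unit_ball : measurable (@unit_ball R n).
Proof. by apply: measurable_open; exact: open_unit_ball. Qed.

Lemma unit_ball_sub_cbox : @unit_ball R n `<=` cbox (fun=> -1) (fun=> 1).
Proof.
move=> x /ltW x1 i; rewrite in_itv/=; have := abs_coord_le_euclid x i.
by move=> /le_trans/(_ x1); rewrite ler_norml.
Qed.

Lemma unit_ball_lty : (mu (@unit_ball R n) < +oo)%E.
Proof.
apply: (@le_lt_trans _ _ (mu (cbox (fun=> -1) (fun=> 1)))); first apply: le_measure.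
- by rewrite inE; exact: measurable_unit_ball.
- by rewrite inE; exact: measurable_cbox.
- exact: unit_ball_sub_cbox.
- by rewrite lebesgue_cbox ?ltry// => i; lra.
Qed.

(** The origin is a degenerate box, and n > 0 provides a zero factor in its volume; on R^0 the
    measure is the Dirac mass. *)
Lemma lebesgue_set0 : (0 < n)%N -> mu [set 0] = 0%E.
Proof.
move=> n0; rewrite (_ : [set 0] = cbox (fun=> 0) (fun=> 0)); last first.
  apply/seteqP; split => [_ -> i|x x0]; first by rewrite mxE in_itv/= lexx.
  apply/rowP => i; have := x0 i; rewrite in_itv/= mxE => h.
  by apply/eqP; rewrite eq_le andbC.
rewrite lebesgue_cbox// -(prednK n0) big_ord_recl subrr mul0r//.
Qed.

End borel_rV.

(** * Integrals of partial derivatives *)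

Section divergence.
Context {R : realType}.

Lemma compact_cbox n (a b : 'I_n -> R) : compact (cbox a b).
Proof.
exact: (@rV_compact R n (fun i => `[a i, b i]%classic) (fun i => @segment_compact _ _ _)).
Qed.

Lemma continuous_compact_le n (K : set 'rV[R]_n) (G : 'rV[R]_n -> R) :
  compact K -> continuous G -> exists C, 0 <= C /\ forall x, K x -> `|G x| <= C.
Proof.
move=> cK cG; have [->|K0] := eqVneq K set0; first by exists 0; split.
have cnG : {within K, continuous (fun x => `|G x|)}.
  apply: continuous_subspaceT => x; apply: continuous_comp; first exact: cG.
  exact: norm_continuous.
have /set0P K0' := K0.
have [c _ cmax] := EVT_max_rV K0' cK cnG.
exists `|G c|; split => // x Kx; apply: cmax.
by rewrite inE.
Qed.

(** Compact support is expressed through coordinates because this form passes to slices in Fubini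
    arguments. *)
Lemma integrable_continuous_box n (G : 'rV[R]_n -> R) (M : R) :
  continuous G -> (forall x : 'rV[R]_n, (exists i : 'I_n, M < `|x ord0 i|) -> G x = 0) ->
  (lebesgue_rV n).-integrable setT (EFin \o G).
Proof.
move=> cG G0; have mG := measurable_fun_rV_continuous cG.
have G1 x : ~ cbox (fun=> - M) (fun=> M) x -> G x = 0.
  move=> Mx; apply: G0; apply: contrapT => /forallNP Mx'; apply: Mx => i.
  by rewrite in_itv/= -ler_norml leNgt; apply/negP/Mx'.
have mB : measurable (cbox (fun i : 'I_n => - M) (fun=> M)) by exact: measurable_cbox.
rewrite (_ : EFin \o G = (EFin \o G) \_ (cbox (fun=> - M) (fun=> M))); last first.
  apply/funext => x; rewrite /patch; case: ifPn => //=.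
  by rewrite notin_setE => /G1 ->.
apply/(integrable_mkcond _ mB).
have [C [_ GC]] := continuous_compact_le (@compact_cbox n (fun=> - M) (fun=> M)) cG.
apply: measurable_bounded_integrable => //.
(* M may be negative, so the volume formula is applied to the box of half-width [|M|]. *)
- apply: (@le_lt_trans _ _ (lebesgue_rV n (cbox (fun=> - (`|M|)) (fun=> `|M|))));
  first apply: le_measure.
  + by rewrite inE.
  + by rewrite inE; exact: measurable_cbox.
  + move=> x Mx i; have := Mx i; rewrite !in_itv/= => /andP[? ?].
    by have := ler_norm M => ?; apply/andP; split; lra.
  + rewrite lebesgue_cbox ?ltry// => i.
    by rewrite ge0_cp//.
- exact: measurable_funTS.
- exists C; split; first exact: num_real.
  by move=> D CD x Mx; apply: le_trans (GC _ Mx) (ltW CD).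
Qed.

(** Fundamental theorem of calculus on an interval [-N, N] with N > M, at whose endpoints F
    vanishes. *)
Lemma integral_derive1_eq0 (F : R -> R) (M : R) :
  (forall x, derivable F x 1) -> continuous ('D_1 F) ->
  (forall x : R, M < `|x| -> F x = 0) ->
  (\int[lebesgue_measure]_x ('D_1 F x)%:E = 0)%E.
Proof.
move=> dF cF F0; pose N := `|M| + 1.
have MN : M < N by have := ler_norm M; rewrite /N; lra.
have N0 : 0 < N by rewrite /N; have := normr_ge0 M; lra.
have F0' (x : R) : M < `|x| -> 'D_1 F x = 0.
  move=> Mx; rewrite (@near_eq_derive _ _ _ F (cst 0)) ?derive_cst//.
  near=> y; apply: F0; near: y.
  by apply: (cvgr_gt (`|x|)) => //; exact: norm_continuous.
rewrite (_ : (fun x => ('D_1 F x)%:E) = (fun x => ('D_1 F x)%:E) \_ `[- N, N]); last first.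
  apply/funext => x; rewrite /patch; case: ifPn => //.
  rewrite notin_setE/= in_itv/= -ler_norml => /negP; rewrite -ltNge => Nx.
  by rewrite F0'// (lt_trans MN).
have cF' : continuous F by move=> x; apply/differentiable_continuous/derivable1_diffP.
rewrite -integral_mkcond (@continuous_FTC2 _ _ F)//; first last.
- by move=> x _; rewrite derive1E.
- by split => //; [apply: cvg_at_right_filter|apply: cvg_at_left_filter]; exact: cF'.
- exact: continuous_subspaceT.
- by lra.
by rewrite !F0 ?normrN ?(gtr0_norm N0)// subee.
Unshelve. all: by end_near. Qed.

Lemma rV_cons_lift n (h a : R) (j : 'I_n) (x : 'rV[R]_n) :
  h *: delta_mx ord0 (lift ord0 j) + rV_cons (a, x) =
  rV_cons (a, h *: delta_mx ord0 j + x).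
Proof.
apply/rowP => i; rewrite !mxE; case: unliftP => [k|] ->; last first.
  by rewrite /= mulr0 add0r.
by rewrite !mxE (inj_eq lift_inj).
Qed.

Lemma rV_cons_ord0 n (h a : R) (x : 'rV[R]_n) :
  h *: delta_mx ord0 ord0 + rV_cons (a, x) = rV_cons (h + a, x).
Proof.
apply/rowP => i; rewrite !mxE; case: unliftP => [k|] ->; last first.
  by rewrite /= mulr1.
by rewrite /= mulr0 add0r.
Qed.

Lemma continuous_rV_consr n a : continuous (fun x : 'rV[R]_n => rV_cons (a, x)).
Proof.
move=> x; move=> A /nbhs_ballP[e e0 eA]; apply/nbhs_ballP; exists e => // y [_ yx].
apply: eA; split => // i j.
by rewrite (ord1 i) !mxE; case: (unlift _ _) => [k|]; [exact: yx|exact: ballxx].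
Qed.

Lemma continuous_rV_consl n (x : 'rV[R]_n) : continuous (fun a : R => rV_cons (a, x)).
Proof.
move=> a; move=> A /nbhs_ballP[e e0 eA]; apply/nbhs_ballP; exists e => // b ab.
apply: eA; split => // i j.
by rewrite (ord1 i) !mxE; case: (unlift _ _) => [k|]; [exact: ballxx|exact: ab].
Qed.

(** A directional derivative depends only on the restriction to a line. This transports partial
    derivatives to slices and to functions of one variable. *)
Lemma eq_along_derive (V W : normedModType R) (f : V -> R) (g : W -> R) v w x y :
  (forall h : R, f (h *: v + x) = g (h *: w + y)) ->
  (derivable f x v -> derivable g y w) /\ 'D_v f x = 'D_w g y.
Proof.
move=> fg; have fg0 : f x = g y by have := fg 0; rewrite !scale0r !add0r.
have E : (fun h => h^-1 *: ((f \o shift x) (h *: v) - f x)) =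
         (fun h => h^-1 *: ((g \o shift y) (h *: w) - g y)).
  by apply/funext => h /=; rewrite fg fg0.
by split; rewrite /derivable /derive E.
Qed.

Lemma rV_cons_ord0_derive n (F : 'rV[R]_n.+1 -> R) a x :
  (derivable F (rV_cons (a, x)) (delta_mx ord0 ord0) ->
   derivable (fun a => F (rV_cons (a, x))) a 1) /\
  partial ord0 F (rV_cons (a, x)) = 'D_1 (fun a => F (rV_cons (a, x))) a.
Proof.
by apply: eq_along_derive => h; rewrite rV_cons_ord0 [_%:A]mulr1.
Qed.

Lemma rV_cons_lift_derive n (F : 'rV[R]_n.+1 -> R) a x j :
  (derivable F (rV_cons (a, x)) (delta_mx ord0 (lift ord0 j)) ->
   derivable (fun x => F (rV_cons (a, x))) x (delta_mx ord0 j)) /\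
  partial (lift ord0 j) F (rV_cons (a, x)) = partial j (fun x => F (rV_cons (a, x))) x.
Proof. by apply: eq_along_derive => h; rewrite rV_cons_lift. Qed.

Lemma integral_lebesgue_cons n (f : 'rV[R]_n.+1 -> \bar R) :
  measurable_fun setT f ->
  (lebesgue_measure \x lebesgue_rV n)%E.-integrable setT (f \o @rV_cons R n) ->
  (\int[lebesgue_rV n.+1]_x f x =
   \int[lebesgue_measure \x lebesgue_rV n]_p f (rV_cons p))%E.
Proof.
move=> mf intf.
have H := @integral_pushforward _ _ (measurableTypeR R * 'rV[R]_n)%type _ R
  (@rV_cons R n) (@measurable_rV_cons R n)
  [the {measure set _ -> \bar R} of (@lebesgue_measure R \x lebesgue_rV n)%E]
  setT f mf intf (@measurableT _ _).
exact: H.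
Qed.

(** Induction on the dimension by Fubini. If k is not the first coordinate, the inner integral over
    the slice vanishes by induction; if it is, the order of integration is exchanged and the
    one-dimensional case applies. *)
Lemma integral_partial_eq0 n (k : 'I_n) (F : 'rV[R]_n -> R) (M : R) :
  (forall x, derivable F x (delta_mx ord0 k)) -> continuous (partial k F) ->
  (forall x : 'rV[R]_n, (exists i : 'I_n, M < `|x ord0 i|) -> F x = 0) ->
  (\int[lebesgue_rV n]_x (partial k F x)%:E = 0)%E.
Proof.
elim: n => [|n IHn] in k F *; first by case: k.
move=> dF cF F0.
(* The condition on x is open, so F vanishes near x and its derivative there is 0. *)
have F0' (x : 'rV[R]_n.+1) : (exists i : 'I_n.+1, M < `|x ord0 i|) -> partial k F x = 0.
  case=> i Mx; rewrite /partial (@near_eq_derive _ _ _ F (cst 0)) ?derive_cst//.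
  near=> y; apply: F0; exists i; near: y.
  apply: (cvgr_gt (`|x ord0 i|)) => //.
  apply: (@continuous_comp _ _ _ (fun x : 'rV[R]_n.+1 => x ord0 i)).
    exact: continuous_coord.
  exact: norm_continuous.
have iF := integrable_continuous_box cF F0'.
have mF := measurable_fun_rV_continuous cF.
have iFc : (lebesgue_measure \x lebesgue_rV n)%E.-integrable setT
    ((EFin \o partial k F) \o @rV_cons R n).
  apply/integrableP; split.
    apply/measurable_EFinP; apply: measurableT_comp mF _.
    exact: measurable_rV_cons.
  have /integrableP[_] := iF; rewrite [X in (X < _)%E -> _]ge0_integral_pushforward//.
    exact: measurable_rV_cons.
  by apply: measurableT_comp => //; exact/measurable_EFinP.
rewrite integral_lebesgue_cons//; last exact/measurable_EFinP.
have [j kj|k0] := unliftP ord0 k.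
- rewrite -integral12_prod_meas1//; rewrite (eq_integral (cst 0%E)) ?integral0// => a _.
  rewrite /fubini_F /= (eq_integral (fun x => (partial j (fun x => F (rV_cons (a, x))) x)%:E)).
    apply: IHn.
    + by move=> x; apply: (rV_cons_lift_derive _ _ _ _).1; rewrite -kj; exact: dF.
    + rewrite (_ : partial j _ = fun x => partial k F (rV_cons (a, x))); last first.
        by apply/funext => x; rewrite kj (rV_cons_lift_derive _ _ _ _).2.
      move=> x; apply: (@continuous_comp _ _ _ (fun x => rV_cons (a, x))); last exact: cF.
      exact: continuous_rV_consr.
    + move=> x [i Mx]; apply: F0; exists (lift ord0 i).
      by rewrite mxE liftK.
  by move=> x _; rewrite kj (rV_cons_lift_derive _ _ _ _).2.
- rewrite -integral21_prod_meas1//; rewrite (eq_integral (cst 0%E)) ?integral0// => x _.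
  rewrite [LHS](_ : _ = \int[lebesgue_measure]_a ('D_1 (fun a => F (rV_cons (a, x))) a)%:E)%E.
    apply: (@integral_derive1_eq0 _ M).
    + by move=> a; apply: (rV_cons_ord0_derive _ _ _).1; rewrite -k0; exact: dF.
    + rewrite (_ : 'D_1 (fun a => F (rV_cons (a, x))) = fun a => partial k F (rV_cons (a, x)));
      last first.
        by apply/funext => a; rewrite k0 (rV_cons_ord0_derive _ _ _).2.
      move=> a; apply: (@continuous_comp _ _ _ (fun a => rV_cons (a, x))); last exact: cF.
      exact: continuous_rV_consl.
    + move=> a Mx; apply: F0; exists ord0.
      by rewrite mxE unlift_none.
  by apply: eq_integral => a _; rewrite /= k0 (rV_cons_ord0_derive _ _ _).2.
Unshelve. all: by end_near. Qed.

End divergence.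

(** * Integrability of |x|^-4 *)

Section radius.
Context {R : realType} {m : nat}.
Local Notation mu := (@lebesgue_rV R m).
Local Notation B := (@unit_ball R m).

(** At the origin the value is 0, the inverse of 0 being 0. *)
Definition rinv (x : 'rV[R]_m) : R := (euclid x)^-1.

Lemma rinv_ge0 x : 0 <= rinv x.
Proof. by rewrite invr_ge0 sqrtr_ge0. Qed.

Lemma measurable_euclid : measurable_fun setT (@euclid R m).
Proof. by apply: measurable_fun_rV_continuous; exact: continuous_euclid. Qed.

Lemma measurable_rinv : measurable_fun setT rinv.
Proof.
rewrite (_ : rinv = (fun t : R => t `^ (-1)) \o @euclid R m).
  by apply: measurableT_comp; [exact: measurable_powR|exact: measurable_euclid].
by apply/funext => x; rewrite /= powR_inv1// sqrtr_ge0.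
Qed.

Definition dyadic_box (n : nat) : set 'rV[R]_m := cbox (fun=> - (2^-1) ^+ n) (fun=> (2^-1) ^+ n).

Lemma measurable_dyadic_box n : measurable (dyadic_box n).
Proof. exact: measurable_cbox. Qed.

Lemma lebesgue_dyadic_box n : mu (dyadic_box n) = ((2 * (2^-1) ^+ n) ^+ m)%:E.
Proof.
rewrite lebesgue_cbox.
  by rewrite prodr_const card_ord; congr (_ ^+ _)%:E; ring.
by move=> i; rewrite ge0_cp// exprn_ge0.
Qed.

(** Taking the least n with 2^-(n+1) <= |x| puts x in the dyadic shell between 2^-(n+1) and 2^-n. *)
Lemma rinv4_le x : B x -> x != 0 ->
  exists n, dyadic_box n x /\ rinv x ^+ 4 <= 16 ^+ n.+1.
Proof.
move=> x1 x0; have r0 : 0 < euclid x by rewrite euclid_gt0.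
have [n] : exists n, (2^-1 : R) ^+ n.+1 <= euclid x.
  have : (2^-1 : R) ^+ n @[n --> \oo] --> 0 by apply: cvg_expr; rewrite ger0_norm//; lra.
  move=> /cvgr0_norm_le/(_ _ r0)[n _ /(_ n.+1 (leqnSn _))/=].
  by rewrite ger0_norm ?exprn_ge0//; exists n.
elim: n => [|n IHn] nx; last first.
  have [/IHn//|xn] := leP ((2^-1 : R) ^+ n.+1) (euclid x).
  exists n.+1; split.
    move=> i; rewrite in_itv/= -ler_norml; apply: le_trans (abs_coord_le_euclid _ _) _.
    exact: ltW.
  have -> : 16 = (2 ^+ 4 : R) by ring.
  rewrite -exprM mulnC exprM lerXn2r// ?nnegrE ?exprn_ge0 ?rinv_ge0//.
  by rewrite -[leRHS]invrK lef_pV2 ?posrE ?invr_gt0 ?exprn_gt0// -exprVn.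
exists 0; split.
  move=> i; rewrite expr0 in_itv/= -ler_norml; apply: le_trans (abs_coord_le_euclid _ _) _.
  exact: ltW.
have -> : 16 = (2 ^+ 4 : R) by ring.
rewrite expr1 lerXn2r// ?nnegrE ?rinv_ge0//.
by rewrite -[leRHS]invrK lef_pV2 ?posrE ?invr_gt0//.
Qed.

Hypothesis m5 : (4 < m)%N.

Lemma lebesgue_origin : mu [set 0] = 0%E.
Proof. by apply: lebesgue_set0; apply: leq_ltn_trans m5. Qed.

(** Dyadic summation: the n-th box contributes 16^(n+1) (2 * 2^-n)^m, a convergent geometric series
    since m >= 5. *)
Lemma integrable_rinv4 : mu.-integrable B (fun x => (rinv x ^+ 4)%:E).
Proof.
have mB : measurable B by exact: measurable_unit_ball.
apply/integrableP; split.
  apply/measurable_EFinP; apply: measurable_funTS.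
  by apply: measurable_funX; exact: measurable_rinv.
(* Off the origin a single term of the sum of these functions already dominates r^-4. *)
pose f n x : \bar R := (16 ^+ n.+1 * \1_(dyadic_box n) x)%:E.
have f0 n x : (0 <= f n x)%E.
  by rewrite lee_fin mulr_ge0// ?exprn_ge0// indicE.
have mf n : measurable_fun B (f n).
  apply: measurable_funTS; apply/measurable_EFinP; apply: measurable_funM => //.
  by apply: measurable_indic; exact: measurable_dyadic_box.
apply: (@le_lt_trans _ _ (\int[mu]_(x in B) \sum_(n <oo) f n x)%E).
  apply: ae_ge0_le_integral => //.
  - apply: measurableT_comp => //; apply/measurable_EFinP; apply: measurable_funTS.
    by apply: measurable_funX; exact: measurable_rinv.
  - by move=> x _; exact: nneseries_ge0.
  - exact: ge0_emeasurable_sum.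
  - exists [set 0]; split; [|exact: lebesgue_origin|].
      by apply: measurable_compact; exact: compact_set1.
    move=> x /= /not_implyP[Bx]; apply: contra_notP => /eqP x0.
    have [n [nx rn]] := rinv4_le Bx x0.
    apply: le_trans (nneseries_lim_ge n.+1 (fun k _ _ => f0 k x)).
    rewrite big_mkord big_ord_recr/=.
    apply: (@le_trans _ _ (f n x)); last by rewrite leeDr// sume_ge0.
    rewrite /f indicE mem_set// mulr1 lee_fin ger0_norm//.
    by rewrite exprn_ge0// rinv_ge0.
rewrite integral_nneseries//.
(* The extra factor 2 compensates for the shifted power 2^(n+1), so the n-th term equals 16 * 2^m *
   2^-n. *)
apply: (@le_lt_trans _ _ (\sum_(n <oo) ((16 * 2 * 2 ^+ m) / (2 ^ n.+1)%:R)%:E)%E).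
  apply: lee_nneseries => [n _ _|n _]; first exact: integral_ge0.
  rewrite /f; under eq_integral do rewrite EFinM.
  rewrite ge0_integralZl_EFin ?exprn_ge0//; last first.
    by apply/measurable_EFinP; apply: measurable_indic; exact: measurable_dyadic_box.
  rewrite integral_indic//; last exact: measurable_dyadic_box.
  apply: (@le_trans _ _ ((16 ^+ n.+1)%:E * mu (dyadic_box n))%E).
    rewrite lee_pmul2l// ?lte_fin ?exprn_gt0//; apply: le_measure; rewrite ?inE.
    + by apply: measurableI => //; exact: measurable_dyadic_box.
    + exact: measurable_dyadic_box.
    + exact: subIsetl.
  rewrite lebesgue_dyadic_box -EFinM lee_fin.
  (* Of the m factors 2^-n, four cancel 16^n, a fifth gives convergence and the others are at most
     1. *)
  have -> : m = (5 + (m - 5))%N by rewrite subnKC.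
  rewrite exprMn !exprD natrX -exprVn.
  set a := (2^-1 : R) ^+ n; set d := (m - 5)%N.
  have a2 : a * 2 ^+ n = 1 by rewrite -exprMn mulVf ?expr1n.
  have -> : 16 ^+ n.+1 = 16 * (2 ^+ n) ^+ 4 :> R.
    by rewrite exprS -exprM mulnC exprM; congr (_ * _ ^+ _); ring.
  have ad : a ^+ d <= 1.
    by rewrite exprn_ile1// ?exprn_ge0// exprn_ile1//; lra.
  have -> : 16 * (2 ^+ n) ^+ 4 * (2 ^+ 5 * 2 ^+ d * (a ^+ 5 * a ^+ d)) =
     (16 * 2 ^+ 5 * 2 ^+ d) * (a * a ^+ d) * (a * 2 ^+ n) ^+ 4 by ring.
  have -> : 16 * 2 * (2 ^+ 5 * 2 ^+ d) * (2^-1 ^+ n.+1) = (16 * 2 ^+ 5 * 2 ^+ d) * a.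
    by rewrite (exprS _ n) -/a; clearbody a; field.
  rewrite a2 expr1n mulr1 ler_pM2l ?mulr_gt0 ?exprn_gt0//.
  by rewrite ler_piMr// exprn_ge0.
apply: le_lt_trans (epsilon_trick0 _ _) _; last exact: ltry.
by rewrite !mulr_ge0// exprn_ge0.
Qed.

End radius.

(** * Differentiation off the origin *)

Section continuity_rules.
Context {R : realType} {T : topologicalType}.
Implicit Types f g : T -> R.

Lemma continuous_funD f g : continuous f -> continuous g ->
  continuous (fun x => f x + g x).
Proof. by move=> cf cg x; exact: continuousD (cf x) (cg x). Qed.

Lemma continuous_funM f g : continuous f -> continuous g ->
  continuous (fun x => f x * g x).
Proof. by move=> cf cg x; exact: continuousM (cf x) (cg x). Qed.

End continuity_rules.

Section partial_rules.
Context {R : realType} {m : nat}.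
Implicit Types (f g : 'rV[R]_m -> R) (x : 'rV[R]_m) (k i : 'I_m).

(* Off the origin, only continuity and coordinatewise derivability are needed. *)
Definition pderivable f x :=
  {for x, continuous f} /\ forall k, derivable f x (delta_mx ord0 k).

Lemma differentiable_pderivable f x : differentiable f x -> pderivable f x.
Proof.
move=> df; split; first exact: differentiable_continuous.
by move=> k; exact: diff_derivable.
Qed.

Lemma pderivableD f g x : pderivable f x -> pderivable g x ->
  pderivable (fun x => f x + g x) x.
Proof.
move=> [cf df] [cg dg]; split; first exact: continuousD.
by move=> k; exact: derivableD.
Qed.

Lemma pderivableM f g x : pderivable f x -> pderivable g x ->
  pderivable (fun x => f x * g x) x.
Proof.
move=> [cf df] [cg dg]; split; first exact: continuousM.
by move=> k; exact: derivableM.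
Qed.

Lemma pderivableV f x : f x != 0 -> pderivable f x -> pderivable (fun x => (f x)^-1) x.
Proof.
move=> f0 [cf df]; split; first exact: continuousV.
by move=> k; exact: derivableV.
Qed.

Lemma partialV k f x : f x != 0 -> pderivable f x ->
  partial k (fun x => (f x)^-1) x = - (partial k f x * (f x)^-1 ^+ 2).
Proof.
move=> f0 [_ df]; rewrite /partial (deriveV f0 (df k)) exprVn.
by rewrite [LHS]mulNr mulrC.
Qed.

Lemma pderivable_cst (c : R) x : pderivable (fun=> c) x.
Proof. by split => [|k]; [exact: cst_continuous|exact: derivable_cst]. Qed.

Lemma eq_pderivable f g x : (\forall y \near x, f y = g y) ->
  pderivable f x -> pderivable g x.
Proof.
move=> fg [cf df]; split => [|k]; last exact: near_eq_derivable (df k).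
move=> A; rewrite -(nbhs_singleton fg) => /cf fA.
have {}fA : nbhs x (f @^-1` A) by [].
by have : nbhs x (g @^-1` A) by apply: filterS2 fg fA => y /= <-.
Qed.

Lemma pderivable_sum (I : eqType) (r : seq I) (F : I -> 'rV[R]_m -> R) x :
  (forall j, pderivable (F j) x) -> pderivable (fun x => \sum_(j <- r) F j x) x.
Proof.
move=> dF; elim: r => [|a r IHr].
  by under eq_fun do rewrite big_nil; exact: pderivable_cst.
by under eq_fun do rewrite big_cons; exact: pderivableD.
Qed.

Lemma partialD k f g x : pderivable f x -> pderivable g x ->
  partial k (fun x => f x + g x) x = partial k f x + partial k g x.
Proof. by move=> [_ df] [_ dg]; exact: deriveD. Qed.

Lemma partialM k f g x : pderivable f x -> pderivable g x ->
  partial k (fun x => f x * g x) x = partial k f x * g x + f x * partial k g x.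
Proof.
move=> [_ df] [_ dg]; rewrite /partial [LHS](deriveM (df k) (dg k)).
by rewrite addrC; congr (_ + _); exact: mulrC.
Qed.

Lemma partial_cst k (c : R) x : partial k (fun=> c) x = 0.
Proof. exact: derive_cst. Qed.

Lemma partialZ k (c : R) f x : pderivable f x ->
  partial k (fun x => c * f x) x = c * partial k f x.
Proof.
move=> df; rewrite partialM; [|exact: pderivable_cst|exact: df].
by rewrite partial_cst mul0r add0r.
Qed.

Lemma partial_sum (I : eqType) (r : seq I) k (F : I -> 'rV[R]_m -> R) x :
  (forall j, pderivable (F j) x) ->
  partial k (fun x => \sum_(j <- r) F j x) x = \sum_(j <- r) partial k (F j) x.
Proof.
move=> dF; elim: r => [|a r IHr].
  by under eq_fun do rewrite big_nil; rewrite big_nil partial_cst.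
under eq_fun do rewrite big_cons; rewrite big_cons -IHr partialD//.
exact: pderivable_sum.
Qed.

Lemma eq_partial k f g x : (\forall y \near x, f y = g y) ->
  partial k f x = partial k g x.
Proof. exact: near_eq_derive. Qed.

Lemma partial_coord k i x : partial k (fun x => x ord0 i) x = (i == k)%:R.
Proof.
have := @eq_along_derive R _ _ (fun x : 'rV[R]_m => x ord0 i) (@idfun R)
  (delta_mx ord0 k) ((i == k)%:R) x (x ord0 i).
case=> [h|_]; first by rewrite !mxE eqxx.
by rewrite derive_id.
Qed.

Lemma near_neq0 x : x != 0 -> \forall y \near x, y != 0.
Proof.
move=> x0; have oD : open (~` [set (0 : 'rV[R]_m)]).
  by apply: closed_openC; apply: compact_closed; [exact: norm_hausdorff|exact: compact_set1].
have : nbhs x (~` [set (0 : 'rV[R]_m)]) by apply: open_nbhs_nbhs; split => //; exact/eqP.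
by apply: filterS => y /eqP.
Qed.

Lemma eq_partial_off0 k f g x : (forall y, y != 0 -> f y = g y) -> x != 0 ->
  partial k f x = partial k g x.
Proof. by move=> fg /near_neq0 x0; apply: eq_partial; near do apply: fg.
Unshelve. all: by end_near. Qed.

Lemma eq_pderivable_off0 f g x : (forall y, y != 0 -> f y = g y) -> x != 0 ->
  pderivable f x -> pderivable g x.
Proof. by move=> fg /near_neq0 x0; apply: eq_pderivable; near do apply: fg.
Unshelve. all: by end_near. Qed.

End partial_rules.

(** * Derivatives of |x|, 1/|x| and x_i/|x| *)

Section radial_derivatives.
Context {R : realType} {m : nat}.
Implicit Types (x : 'rV[R]_m) (k i : 'I_m).

Definition omega i x : R := x ord0 i * rinv x.

Lemma euclid_sqr x : euclid x ^+ 2 = \sum_i x ord0 i ^+ 2.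
Proof. by rewrite sqr_sqrtr// sumr_ge0// => i _; exact: sqr_ge0. Qed.

Lemma sum_omega_sqr x : x != 0 -> \sum_i omega i x ^+ 2 = 1.
Proof.
move=> x0; under eq_bigr do rewrite exprMn.
by rewrite -mulr_suml -euclid_sqr -exprMn divff ?expr1n// euclid_eq0.
Qed.

Lemma pderivable_coord i x : pderivable (fun x => x ord0 i) x.
Proof. by apply: differentiable_pderivable; exact: differentiable_coord. Qed.

Lemma pderivable_euclid x : x != 0 -> pderivable (@euclid R m) x.
Proof.
move=> x0; apply: differentiable_pderivable.
apply: (@differentiable_comp _ _ _ _ (fun x : 'rV[R]_m => \sum_i x ord0 i ^+ 2)).
  have -> : (fun x : 'rV[R]_m => \sum_i x ord0 i ^+ 2) =
      \sum_i (fun x : 'rV[R]_m => x ord0 i) ^+ 2.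
    by apply/funext => y; rewrite fct_sumE.
  by apply: differentiable_sum => i; apply: differentiableX; exact: differentiable_coord.
apply/derivable1_diffP.
have s0 : 0 < \sum_i x ord0 i ^+ 2 by rewrite -euclid_sqr exprn_gt0 // euclid_gt0.
by have [] := is_derive1_sqrt s0.
Qed.

(** Differentiate r * r = sum of the x_i * x_i by the product rule and divide by 2 r. *)
Lemma partial_euclid k x : x != 0 -> partial k (@euclid R m) x = omega k x.
Proof.
move=> x0; have e0 : euclid x != 0 by rewrite euclid_eq0.
have : partial k (fun x => euclid x * euclid x) x =
       partial k (fun x => \sum_i x ord0 i * x ord0 i) x.
  by congr partial; apply/funext => y; rewrite -expr2 euclid_sqr.
have de := pderivable_euclid x0.
rewrite partialM// partial_sum; last by move=> j; apply: pderivableM; exact: pderivable_coord.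
under eq_bigr => i _.
  rewrite partialM ?partial_coord; [|exact: pderivable_coord..].
  over.
rewrite (bigD1 k)//= eqxx big1 ?addr0 => [|i /negPf ->]; last by rewrite !mul0r mulr0 addr0.
rewrite mul1r mulr1 => H; apply: (mulIf e0); rewrite /omega /rinv divfK//.
by move: H; rewrite mulrC => H; lra.
Qed.

Lemma pderivable_rinv x : x != 0 -> pderivable (@rinv R m) x.
Proof.
by move=> x0; apply: pderivableV; [rewrite euclid_eq0|exact: pderivable_euclid].
Qed.

Lemma partial_rinv k x : x != 0 ->
  partial k (@rinv R m) x = - (omega k x * rinv x ^+ 2).
Proof.
move=> x0; rewrite partialV ?euclid_eq0 ?partial_euclid//.
exact: pderivable_euclid.
Qed.

Lemma pderivable_omega i x : x != 0 -> pderivable (omega i) x.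
Proof.
by move=> x0; apply: pderivableM; [exact: pderivable_coord|exact: pderivable_rinv].
Qed.

Lemma partial_omega k i x : x != 0 ->
  partial k (omega i) x = rinv x * ((i == k)%:R - omega i x * omega k x).
Proof.
move=> x0; rewrite partialM; [|exact: pderivable_coord|exact: pderivable_rinv].
by rewrite partial_coord partial_rinv// /omega; ring.
Qed.

End radial_derivatives.

(** * Smooth functions and test functions *)

Section test_functions.
Context {R : realType} {m : nat}.
Implicit Types (phi psi f g : 'rV[R]_m -> R) (x : 'rV[R]_m) (k : 'I_m).

Lemma smooth_partial k f : smooth f -> smooth (partial k f).
Proof. by move=> sf s x; have := sf (rcons s k) x; rewrite foldr_rcons. Qed.

Lemma smooth_differentiable f x : smooth f -> differentiable f x.
Proof. by move=> /(_ [::]). Qed.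

(* Closure of a class of functions under partial derivatives replaces a
   direct induction on iterated derivatives. *)
Lemma smooth_class (S : ('rV[R]_m -> R) -> Prop) :
  (forall f, S f -> (forall x, differentiable f x) /\ forall k, S (partial k f)) ->
  forall f, S f -> smooth f.
Proof.
move=> HS f Sf s; suff [Sg _] : S (foldr partial f s) /\ True by have [] := HS _ Sg.
by elim: s => [//|k s [/HS[_ IH] _]]; split => //; exact: IH.
Qed.

Lemma smooth_cst (c : R) : smooth (fun _ : 'rV[R]_m => c).
Proof.
apply: (@smooth_class (fun f => exists c, f = fun=> c)); last by exists c.
move=> _ [d ->]; split=> [x|k]; first exact: differentiable_cst.
by exists 0; apply/funext => x; rewrite partial_cst.
Qed.

Lemma test_function_smooth phi : test_function phi -> smooth phi.
Proof. by case. Qed.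

Lemma notin_support_near phi x : ~ closure [set x | phi x != 0] x ->
  \forall y \near x, phi y = 0.
Proof.
move=> xn; have : nbhs x (~` closure [set x | phi x != 0]).
  by apply: open_nbhs_nbhs; split => //; apply: closed_openC; exact: closed_closure.
apply: filterS => y yn; apply/eqP; apply: contrapT => /negP py; apply: yn.
exact: subset_closure.
Qed.

Lemma notin_support_partial phi x k : ~ closure [set x | phi x != 0] x ->
  partial k phi x = 0.
Proof.
by move=> /notin_support_near h; rewrite (@eq_partial _ _ _ _ (fun=> 0)) ?partial_cst.
Qed.

Lemma test_function_partial phi k : test_function phi -> test_function (partial k phi).
Proof.
move=> [sphi cphi Bphi].
have sub : closure [set x | partial k phi x != 0] `<=` closure [set x | phi x != 0].
  rewrite [X in _ `<=` X](closure_id _).1; last exact: closed_closure.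
  apply: closure_subset => x /= /eqP; apply: contra_notP; exact: notin_support_partial.
split; first exact: smooth_partial.
- by apply: subclosed_compact sub => //; exact: closed_closure.
- exact: subset_trans sub Bphi.
Qed.

Lemma test_function_out phi x : test_function phi -> ~ unit_ball x -> phi x = 0.
Proof.
move=> [_ _ Bphi] Bx; apply/eqP; apply: contrapT => /negP px; apply: Bx.
by apply: Bphi; exact: subset_closure.
Qed.

Lemma smooth_continuous f : smooth f -> continuous f.
Proof. by move=> sf x; apply: differentiable_continuous; exact: smooth_differentiable. Qed.

Lemma test_function_bounded phi : test_function phi ->
  exists C, 0 <= C /\ forall x, `|phi x| <= C.
Proof.
move=> [sphi cphi Bphi].
have [C [C0 HC]] := continuous_compact_le cphi (smooth_continuous sphi).
exists C; split => // x; have [px|px] := eqVneq (phi x) 0; first by rewrite px normr0.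
by apply: HC; exact: subset_closure.
Qed.

Lemma test_function0 : test_function (fun _ : 'rV[R]_m => 0).
Proof.
have E : [set x : 'rV[R]_m | (0 : R) != 0] = set0.
  by apply/seteqP; split => x //=; rewrite eqxx.
split; first exact: smooth_cst.
- by rewrite E closure0; exact: compact0.
- by rewrite E closure0.
Qed.

End test_functions.

(** * Functions singular at the origin *)

Section singular.
Context {R : realType} {m : nat}.
Implicit Types (f g : 'rV[R]_m -> R) (x : 'rV[R]_m) (k i : 'I_m) (n p : nat).
Local Notation mu := (@lebesgue_rV R m).
Local Notation B := (@unit_ball R m).

(* [sing n f]: off the origin f is smooth and, on the unit ball, O(|x|^-n);
   the class is stable under partial derivatives, which raise n by one. *)
Inductive sing : nat -> ('rV[R]_m -> R) -> Prop :=
| sing_cst (c : R) : sing 0 (fun=> c)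
| sing_omega i : sing 0 (omega i)
| sing_rinv : sing 1 (@rinv R m)
| sing_test f : test_function f -> sing 0 f
| singD n f g : sing n f -> sing n g -> sing n (fun x => f x + g x)
| singM n p f g : sing n f -> sing p g -> sing (n + p) (fun x => f x * g x)
| singW n f : sing n f -> sing n.+1 f
| sing_ext n f g : sing n f -> (forall x, x != 0 -> f x = g x) -> sing n g.

Lemma sing_pderivable n f x : sing n f -> x != 0 -> pderivable f x.
Proof.
move=> sf x0; elim: sf => {n f} [c|i||f tf|n f g _ IHf _ IHg|n p f g _ IHf _ IHg|//|n f g _ IHf fg].
- exact: pderivable_cst.
- exact: pderivable_omega.
- exact: pderivable_rinv.
- by apply: differentiable_pderivable; apply: smooth_differentiable; case: tf.
- exact: pderivableD.
- exact: pderivableM.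
- exact: eq_pderivable_off0 IHf.
Qed.

(** This makes the bounds r^-n increasing in n on the ball, which justifies the weakening rule
    [singW]. *)
Lemma rinv_ge1 x : B x -> x != 0 -> 1 <= rinv x.
Proof.
move=> x1 x0; have r0 : 0 < euclid x by rewrite euclid_gt0.
by rewrite invf_ge1// ltW.
Qed.

Lemma norm_omega i x : `|omega i x| <= 1.
Proof.
rewrite normrM (ger0_norm (rinv_ge0 _)); have [e0|e0] := eqVneq (euclid x) 0.
  by rewrite /rinv e0 invr0 mulr0.
by rewrite ler_pdivrMr ?mul1r ?abs_coord_le_euclid// lt_def e0 sqrtr_ge0.
Qed.

Lemma sing_bound n f : sing n f ->
  exists C, 0 <= C /\ forall x, B x -> x != 0 -> `|f x| <= C * rinv x ^+ n.
Proof.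
have r0 x n' : 0 <= rinv x ^+ n' by rewrite exprn_ge0 ?rinv_ge0.
elim=> {n f} [c|i||f tf|n f g _ [C [C0 HC]] _ [D [D0 HD]]|n p f g _ [C [C0 HC]] _ [D [D0 HD]]
  |n f _ [C [C0 HC]]|n f g _ [C [C0 HC]] fg].
- by exists `|c|; split => // x _ _; rewrite expr0 mulr1.
- by exists 1; split => // x _ _; rewrite expr0 mulr1 norm_omega.
- by exists 1; split => // x _ _; rewrite expr1 mul1r ger0_norm ?rinv_ge0.
- have [C [C0 HC]] := test_function_bounded tf.
  by exists C; split => // x _ _; rewrite expr0 mulr1.
- exists (C + D); split; first exact: addr_ge0.
  by move=> x Bx x0; rewrite mulrDl (le_trans (ler_normD _ _))// lerD ?HC ?HD.
- exists (C * D); split; first exact: mulr_ge0.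
  by move=> x Bx x0; rewrite normrM exprD mulrACA ler_pM ?HC ?HD.
- exists C; split => // x Bx x0; apply: le_trans (HC _ Bx x0) _.
  by rewrite exprS mulrCA ler_peMl ?rinv_ge1// mulr_ge0.
- by exists C; split => // x Bx x0; rewrite -fg// HC.
Qed.

Lemma measurable_set0 : measurable [set (0 : 'rV[R]_m)].
Proof. by apply: measurable_compact; exact: compact_set1. Qed.

(** The rule [sing_ext] leaves the value at the origin arbitrary; in that case g is a case split on
    the measurable set {0}. *)
Lemma sing_measurable n f : sing n f -> measurable_fun setT f.
Proof.
elim=> {n f} [c|i||f tf|n f g _ IHf _ IHg|n p f g _ IHf _ IHg|//|n f g _ IHf fg].
- exact: measurable_cst.
- by apply: measurable_funM; [exact: measurable_rV_coord|exact: measurable_rinv].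
- exact: measurable_rinv.
- by apply: measurable_fun_rV_continuous; apply: smooth_continuous; case: tf.
- exact: measurable_funD.
- exact: measurable_funM.
- rewrite (_ : g = fun x => if x == 0 then g 0 else f x); last first.
    by apply/funext => x; case: eqP => [->//|/eqP x0]; rewrite fg.
  apply: measurable_fun_ifT => //; apply: (measurable_fun_bool true).
  rewrite setTI (_ : _ @^-1` _ = [set (0 : 'rV[R]_m)]); first exact: measurable_set0.
  by apply/seteqP; split => x /= /eqP.
Qed.

Lemma sing_le n p f : (n <= p)%N -> sing n f -> sing p f.
Proof. by move=> /subnKC <-; elim: (p - n)%N => [|d IH] sf; rewrite ?addn0// addnS;
  apply/singW/IH. Qed.

Lemma singB n f g : sing n f -> sing n g -> sing n (fun x => f x - g x).
Proof.
move=> sf sg; apply: (sing_ext (f := fun x => f x + (-1) * g x)) => [|x _].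
  by apply: singD => //; exact: (singM (sing_cst (-1)) sg).
by rewrite mulN1r.
Qed.

Lemma singZ n (c : R) f : sing n f -> sing n (fun x => c * f x).
Proof. by move=> sf; exact: (singM (sing_cst c) sf). Qed.

Lemma sing_sum (I : eqType) (r : seq I) n (F : I -> 'rV[R]_m -> R) :
  (forall j, sing n (F j)) -> sing n (fun x => \sum_(j <- r) F j x).
Proof.
move=> sF; elim: r => [|a r IHr].
  by under eq_fun do rewrite big_nil; apply: (sing_le (leq0n n)); exact: sing_cst.
by under eq_fun do rewrite big_cons; exact: singD.
Qed.

Lemma sing_partial n f k : sing n f -> sing n.+1 (partial k f).
Proof.
elim=> {n f} [c|i||f tf|n f g sf IHf sg IHg|n p f g sf IHf sg IHg|n f sf IHf|n f g sf IHf fg].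
- by apply: (sing_ext (sing_le (leq0n 1) (sing_cst 0))) => x _; rewrite partial_cst.
- apply: (sing_ext (f := fun x => rinv x * ((i == k)%:R - omega i x * omega k x))).
    apply: (singM sing_rinv); apply: singB; first exact: sing_cst.
    exact: (singM (sing_omega i) (sing_omega k)).
  by move=> x x0; rewrite partial_omega.
- apply: (sing_ext (f := fun x => -1 * omega k x * (rinv x * rinv x))).
    exact: (@singM 0 2 _ _ (singZ (-1) (sing_omega k)) (singM sing_rinv sing_rinv)).
  by move=> x x0; rewrite partial_rinv//; ring.
- by apply: singW; apply: sing_test; exact: test_function_partial.
- apply: (sing_ext (singD IHf IHg)) => x x0.
  by rewrite partialD//; [exact: sing_pderivable sf _|exact: sing_pderivable sg _].
- apply: (sing_ext (f := fun x => partial k f x * g x + f x * partial k g x)).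
    apply: singD; first exact: (singM IHf sg).
    by rewrite -addnS; exact: (singM sf IHg).
  move=> x x0; rewrite partialM//; [exact: sing_pderivable sf _|exact: sing_pderivable sg _].
- exact: singW.
- by apply: (sing_ext IHf) => x x0; exact: eq_partial_off0.
Qed.

Hypothesis m5 : (4 < m)%N.

Lemma integrable_unit_ball_cst (c : R) : mu.-integrable B (fun=> c%:E).
Proof.
apply: (@measurable_bounded_integrable _ _ _ mu (fun=> c)).
- exact: measurable_unit_ball.
- exact: unit_ball_lty.
- exact: measurable_cst.
- by exists `|c|; split => [|M /ltW cM x _]; first exact: num_real.
Qed.

Lemma sing_integrable n f : (n <= 4)%N -> sing n f -> mu.-integrable B (EFin \o f).
Proof.
move=> n4 /(sing_le n4) sf; have [C [C0 HC]] := sing_bound sf.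
have mB : measurable B by exact: measurable_unit_ball.
(* The bound holds only off the origin; the constant [|f 0|] covers the arbitrary value there. *)
apply: (@le_integrable _ _ _ mu B mB _ (fun x => (C * rinv x ^+ 4 + `|f 0|)%:E)).
- by apply/measurable_EFinP; apply: measurable_funTS; exact: sing_measurable sf.
- move=> x Bx; rewrite /= lee_fin.
  have C4 : 0 <= C * rinv x ^+ 4 by rewrite mulr_ge0 ?exprn_ge0 ?rinv_ge0.
  rewrite [leRHS]ger0_norm ?addr_ge0//.
  have [->|x0] := eqVneq x 0; first by rewrite lerDr mulr_ge0 ?exprn_ge0 ?rinv_ge0.
  by rewrite -[leLHS]addr0 lerD// HC.
- rewrite (_ : (fun x => _) = (fun x => C%:E * (rinv x ^+ 4)%:E + `|f 0|%:E)%E)//.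
  apply: integrableD => //; last exact: integrable_unit_ball_cst.
  by apply: integrableZl => //; exact: integrable_rinv4.
Qed.


(* The rational cutoff (r^2 / (r^2 + e))^3 vanishes to order 6 at the origin,
   is at most 1, and its gradient is at most 6/r uniformly in e. *)
Definition cutbase (e : R) x := 1 - e * (euclid x ^+ 2 + e)^-1.

Definition cutoff (e : R) x := cutbase e x ^+ 3.

(** The gradient of [cutoff] computed off the origin, written so that it is continuous on the whole
    space. *)
Definition dcutoff (e : R) k x :=
  3 * cutbase e x ^+ 2 * (e * (2 * x ord0 k) * (euclid x ^+ 2 + e)^-1 ^+ 2).

(** * Estimates for the cutoff and its gradient *)

Section cutoff.
Variable e : R.
Hypothesis e0 : 0 < e.

Let u0 x : 0 < euclid x ^+ 2 + e.
Proof. by rewrite ltr_wpDl// sqr_ge0. Qed.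

Let cont_u : continuous (fun x : 'rV[R]_m => euclid x ^+ 2 + e).
Proof.
apply: continuous_funD; last exact: cst_continuous.
by under eq_fun do rewrite expr2; apply: continuous_funM; exact: continuous_euclid.
Qed.

Let cont_uV : continuous (fun x : 'rV[R]_m => (euclid x ^+ 2 + e)^-1).
Proof.
by move=> x; apply: (@continuousV _ _ (fun x : 'rV[R]_m => euclid x ^+ 2 + e));
  [rewrite gt_eqF|exact: cont_u].
Qed.

Lemma continuous_cutbase : continuous (cutbase e).
Proof.
have -> : cutbase e = fun x => 1 + (- e) * (euclid x ^+ 2 + e)^-1.
  by apply/funext => x; rewrite mulNr.
apply: continuous_funD; first exact: cst_continuous.
by apply: continuous_funM; [exact: cst_continuous|exact: cont_uV].
Qed.

Lemma continuous_cutoff : continuous (cutoff e).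
Proof.
move=> x; apply: (@continuous_comp _ _ _ (cutbase e) (fun t : R => t ^+ 3)).
  exact: continuous_cutbase.
exact: exprn_continuous.
Qed.

Lemma continuous_dcutoff k : continuous (dcutoff e k).
Proof.
apply: continuous_funM.
  apply: continuous_funM; first exact: cst_continuous.
  move=> x; apply: (@continuous_comp _ _ _ (cutbase e) (fun t : R => t ^+ 2)).
    exact: continuous_cutbase.
  exact: exprn_continuous.
apply: continuous_funM.
  apply: continuous_funM; first exact: cst_continuous.
  by apply: continuous_funM; [exact: cst_continuous|exact: continuous_coord].
move=> x; apply: (@continuous_comp _ _ _ (fun x : 'rV[R]_m => (euclid x ^+ 2 + e)^-1)
  (fun t : R => t ^+ 2)).
  exact: cont_uV.
exact: exprn_continuous.
Qed.

Lemma pderivable_cutbase x : x != 0 -> pderivable (cutbase e) x /\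
  forall k, partial k (cutbase e) x = e * (2 * x ord0 k) * (euclid x ^+ 2 + e)^-1 ^+ 2.
Proof.
move=> x0; have de := pderivable_euclid x0.
have du := pderivableD (pderivableM de de) (pderivable_cst e x).
have ux : euclid x * euclid x + e != 0 by rewrite -expr2 gt_eqF.
have dv := pderivableV ux du.
have -> : cutbase e = fun x => 1 + (- e) * (euclid x * euclid x + e)^-1.
  by apply/funext => y; rewrite /cutbase mulNr -expr2.
have dw := pderivableM (pderivable_cst (- e) x) dv.
split; first exact: (pderivableD (pderivable_cst 1 x) dw).
move=> k; rewrite (partialD _ (pderivable_cst 1 x) dw) partial_cst add0r.
rewrite (partialZ _ _ dv) (partialV _ ux du).
rewrite (partialD _ (pderivableM de de) (pderivable_cst e x)) (partialM _ de de).
rewrite partial_cst partial_euclid// addr0 /omega /rinv.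
have e1 : euclid x != 0 by rewrite euclid_eq0.
have -> : euclid x * (x ord0 k / euclid x) = x ord0 k by rewrite mulrC divfK.
by rewrite divfK// -expr2; ring.
Qed.

Lemma pderivable_cutoff x : x != 0 -> pderivable (cutoff e) x /\
  forall k, partial k (cutoff e) x = dcutoff e k x.
Proof.
move=> /pderivable_cutbase[db pb].
have -> : cutoff e = fun x => cutbase e x * (cutbase e x * cutbase e x).
  by apply/funext => y; rewrite /cutoff !exprS expr0 mulr1.
have db2 := pderivableM db db.
split; first exact: (pderivableM db db2).
by move=> k; rewrite (partialM _ db db2) (partialM _ db db) pb /dcutoff; ring.
Qed.

(** The defining form suits differentiation and the limit e -> 0; the quotient shows the sign, the
    bound 1 and the order of vanishing. *)
Lemma cutbaseE x : cutbase e x = euclid x ^+ 2 * (euclid x ^+ 2 + e)^-1.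
Proof. by rewrite /cutbase; field; exact: lt0r_neq0. Qed.

Lemma cutbase_ge0 x : 0 <= cutbase e x.
Proof. by rewrite cutbaseE mulr_ge0 ?sqr_ge0// invr_ge0 ltW. Qed.

Lemma cutbase_le1 x : cutbase e x <= 1.
Proof. by rewrite cutbaseE ler_pdivrMr// mul1r lerDl ltW. Qed.

Lemma cutbase_le x : cutbase e x <= euclid x ^+ 2 * e^-1.
Proof. by rewrite cutbaseE ler_wpM2l ?sqr_ge0// lef_pV2 ?posrE// lerDr sqr_ge0. Qed.

Lemma cutoff_ge0 x : 0 <= cutoff e x.
Proof. by rewrite exprn_ge0// cutbase_ge0. Qed.

Lemma cutoff_le1 x : cutoff e x <= 1.
Proof. by rewrite exprn_ile1// ?cutbase_ge0 ?cutbase_le1. Qed.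

Lemma cutoff_le x : cutoff e x <= euclid x ^+ 6 * e^-1 ^+ 3.
Proof.
have -> : euclid x ^+ 6 * e^-1 ^+ 3 = (euclid x ^+ 2 * e^-1) ^+ 3 by ring.
rewrite lerXn2r ?nnegrE ?cutbase_ge0 ?cutbase_le//.
by rewrite mulr_ge0 ?sqr_ge0// invr_ge0 ltW.
Qed.

Let w x := (euclid x ^+ 2 + e)^-1.

Let w0 x : 0 <= w x.
Proof. by rewrite invr_ge0 ltW. Qed.

Let ew1 x : e * w x <= 1.
Proof. by rewrite ler_pdivrMr// mul1r lerDr sqr_ge0. Qed.

Lemma norm_dcutoff k x : `|dcutoff e k x| =
  6 * (cutbase e x ^+ 2 * ((e * w x) * (w x * `|x ord0 k|))).
Proof.
rewrite (_ : 6 * _ = 6 * cutbase e x ^+ 2 * (e * w x) * w x * `|x ord0 k|); last by ring.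
rewrite (_ : dcutoff e k x = 6 * cutbase e x ^+ 2 * (e * w x) * w x * x ord0 k).
  by rewrite normrM [X in X * _]ger0_norm// !mulr_ge0// ?exprn_ge0 ?cutbase_ge0 ?ltW.
by rewrite /dcutoff -/(w x); ring.
Qed.

(** Uniform in e, as dominated convergence requires: the factors [cutbase e x ^+ 2] and e / (r^2 +
    e) are at most 1, and |x_k| / (r^2 + e) <= 1/r. *)
Lemma dcutoff_le_rinv k x : x != 0 -> `|dcutoff e k x| <= 6 * rinv x.
Proof.
move=> x0; rewrite norm_dcutoff ler_pM2l//.
have r0 : 0 < euclid x by rewrite euclid_gt0.
have b0 := cutbase_ge0 x; have b1 := cutbase_le1 x.
have wr : w x <= rinv x ^+ 2.
  by rewrite /w /rinv exprVn lef_pV2 ?posrE// ?exprn_gt0// lerDl ltW.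
have H1 : w x * `|x ord0 k| <= rinv x.
  have -> : rinv x = rinv x ^+ 2 * euclid x by rewrite expr2 -mulrA mulVf ?mulr1 ?gt_eqF.
  by apply: ler_pM => //; exact: abs_coord_le_euclid.
have H2 : cutbase e x ^+ 2 * (e * w x) <= 1.
  by rewrite mulr_ile1 ?exprn_ge0 ?exprn_ile1// mulr_ge0// ltW.
rewrite mulrA -[leRHS]mul1r; apply: ler_pM => //; last by rewrite mulr_ge0.
by rewrite mulr_ge0 ?exprn_ge0// mulr_ge0// ltW.
Qed.

(** For fixed e, the order of vanishing at the origin; the constant blows up as e -> 0, so this
    bound serves only for regularity. *)
Lemma dcutoff_le k x : `|dcutoff e k x| <= 6 * e^-1 ^+ 3 * euclid x ^+ 5.
Proof.
rewrite norm_dcutoff.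
have eV0 : 0 <= e^-1 by rewrite invr_ge0 ltW.
have b0 := cutbase_ge0 x; have r0 : 0 <= euclid x by rewrite sqrtr_ge0.
have we : w x <= e^-1 by rewrite lef_pV2 ?posrE// lerDr sqr_ge0.
rewrite (_ : 6 * e^-1 ^+ 3 * euclid x ^+ 5 =
  6 * ((euclid x ^+ 2 * e^-1) ^+ 2 * (1 * (e^-1 * euclid x)))); last by ring.
rewrite ler_pM2l//.
have H1 : w x * `|x ord0 k| <= e^-1 * euclid x.
  by apply: ler_pM => //; exact: abs_coord_le_euclid.
have H2 : cutbase e x ^+ 2 <= (euclid x ^+ 2 * e^-1) ^+ 2.
  by rewrite lerXn2r ?nnegrE ?cutbase_le// mulr_ge0 ?sqr_ge0.
have ew0 : 0 <= e * w x by rewrite mulr_ge0// ltW.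
have wx0 : 0 <= w x * `|x ord0 k| by rewrite mulr_ge0.
by apply: ler_pM; rewrite ?exprn_ge0//; [exact: mulr_ge0|exact: ler_pM].
Qed.

End cutoff.

End singular.

(** * Integration by parts across the origin *)

Lemma squeeze_norm_cvg0 (R : realType) (T : Type) (F : set_system T) (FF : Filter F)
    (f h : T -> R) :
  (forall x, `|f x| <= h x) -> h x @[x --> F] --> (0 : R) ->
  f x @[x --> F] --> (0 : R).
Proof.
move=> fh /cvgr0Pnorm_le h0; apply/cvgr0Pnorm_le => e e0.
apply: filterS (h0 _ e0) => x; apply: le_trans.
by rewrite (le_trans (fh x))// ler_norm.
Qed.

Section by_parts.
Context {R : realType} {m : nat}.
Implicit Types (f g : 'rV[R]_m -> R) (x : 'rV[R]_m) (k i : 'I_m) (n p : nat).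
Local Notation mu := (@lebesgue_rV R m).
Local Notation B := (@unit_ball R m).

Lemma euclidZ_delta (h : R) k : euclid (h *: delta_mx ord0 k : 'rV[R]_m) = `|h|.
Proof.
rewrite /euclid (bigD1 k)//= !mxE !eqxx mulr1 big1 ?addr0 ?sqrtr_sqr// => i ik.
by rewrite !mxE (negPf ik) andbF mulr0 expr0n.
Qed.

Lemma euclid0 : euclid (0 : 'rV[R]_m) = 0.
Proof. by apply/eqP; rewrite euclid_eq0. Qed.

Lemma euclidK x : x != 0 -> euclid x * rinv x = 1.
Proof. by move=> x0; rewrite divff// euclid_eq0. Qed.

(** * Removing the singularity by the cutoff, for fixed e *)

Section regularized.
Variables (G : 'rV[R]_m -> R) (k : 'I_m) (C D e : R).
Hypotheses (sG : sing 3 G) (C0 : 0 <= C) (D0 : 0 <= D) (e0 : 0 < e).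
Hypothesis GC : forall x, x != 0 -> `|G x| <= C * rinv x ^+ 3.
Hypothesis GD : forall x, x != 0 -> `|partial k G x| <= D * rinv x ^+ 4.
Hypothesis GB : forall x, ~ B x -> G x = 0.

Hypothesis GB' : forall x, ~ B x -> partial k G x = 0.

Let F x := cutoff e x * G x.
Let dF x := dcutoff e k x * G x + cutoff e x * partial k G x.

Let F0 : F 0 = 0.
Proof. by rewrite /F /cutoff cutbaseE// euclid0 expr0n mul0r expr0n mul0r. Qed.

Let dF0 : dF 0 = 0.
Proof.
rewrite /dF /cutoff cutbaseE// euclid0 expr0n mul0r expr0n [X in _ + X]mul0r addr0.
by rewrite /dcutoff mxE !(mulr0, mul0r).
Qed.

(** Order 6 from the cutoff against order -3 from G. *)
Let F_le x : `|F x| <= C * e^-1 ^+ 3 * euclid x ^+ 3.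
Proof.
have [->|x0] := eqVneq x 0; first by rewrite F0 normr0 euclid0 expr0n mulr0.
rewrite normrM ger0_norm ?cutoff_ge0//.
apply: (@le_trans _ _ (euclid x ^+ 6 * e^-1 ^+ 3 * (C * rinv x ^+ 3))).
  by apply: ler_pM; rewrite ?cutoff_ge0 ?cutoff_le ?GC.
rewrite (_ : _ * _ = C * e^-1 ^+ 3 * euclid x ^+ 3 * (euclid x * rinv x) ^+ 3); last by ring.
by rewrite euclidK// expr1n mulr1.
Qed.

Let dF_le x : `|dF x| <= (6 * C + D) * e^-1 ^+ 3 * euclid x ^+ 2.
Proof.
have [->|x0] := eqVneq x 0; first by rewrite dF0 normr0 euclid0 expr0n mulr0.
apply: (le_trans (ler_normD _ _)); rewrite (normrM (dcutoff e k x)) (normrM (cutoff e x)).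
rewrite (ger0_norm (cutoff_ge0 e0 _)).
apply: (@le_trans _ _ ((6 * e^-1 ^+ 3 * euclid x ^+ 5) * (C * rinv x ^+ 3) +
    euclid x ^+ 6 * e^-1 ^+ 3 * (D * rinv x ^+ 4))).
  apply: lerD; apply: ler_pM; rewrite ?cutoff_ge0 ?cutoff_le ?GC ?GD//.
  exact: dcutoff_le.
rewrite [leLHS](_ : _ = 6 * C * e^-1 ^+ 3 * euclid x ^+ 2 * (euclid x * rinv x) ^+ 3
  + D * e^-1 ^+ 3 * euclid x ^+ 2 * (euclid x * rinv x) ^+ 4); last by ring.
by rewrite euclidK// !expr1n !mulr1 -!mulrDl.
Qed.

(** Off the origin this is the product rule. At the origin F = O(r^3), so the difference quotient is
    O(h^2) and the derivative is 0, the value of dF there. *)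
Let F_derive x : derivable F x (delta_mx ord0 k) /\ partial k F x = dF x.
Proof.
have [->|x0] := eqVneq x 0; last first.
  have [dc pc] := pderivable_cutoff e0 x0.
  have dG := sing_pderivable sG x0.
  split; first by case: (pderivableM dc dG).
  by rewrite (partialM _ dc dG) pc.
suff : h^-1 *: ((F \o shift 0) (h *: delta_mx ord0 k) - F 0) @[h --> 0^'] --> 0.
  move=> H; split; first by apply/cvg_ex; exists 0.
  by rewrite dF0; apply/cvg_lim.
apply/cvgr0Pnorm_le => _/posnumP[eps].
pose c := C * e^-1 ^+ 3.
have c0 : 0 <= c by rewrite mulr_ge0 ?exprn_ge0 ?invr_ge0 ?(ltW e0).
near=> h; have h0 : h != 0 by near: h; exact: nbhs_dnbhs_neq.
rewrite F0 subr0 /= addr0 [X in X <= _]normrM normfV ler_pdivrMl ?normr_gt0//.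
apply: le_trans (F_le _) _; rewrite euclidZ_delta -/c exprS mulrCA ler_wpM2l//.
have h1 : `|h| <= 1 by near: h; apply: dnbhs0_le.
(* The constant c may be 0; c + 1 keeps the quotient meaningful. *)
have h2 : `|h| <= eps%:num / (c + 1) by near: h; apply: dnbhs0_le; rewrite divr_gt0// ltr_wpDl.
apply: (@le_trans _ _ ((c + 1) * `|h|)).
  apply: ler_pM; rewrite ?exprn_ge0 ?lerDl//.
  by rewrite expr2 ler_piMl.
by rewrite mulrC -ler_pdivlMr// ltr_wpDl.
Unshelve. all: by end_near. Qed.

Let dF_cont : continuous dF.
Proof.
move=> x; have [->|x0] := eqVneq x 0; last first.
  have [cG _] := sing_pderivable sG x0.
  have [cdG _] := sing_pderivable (sing_partial k sG) x0.
  apply: (@continuousD _ _ _ (fun x => dcutoff e k x * G x) (fun x => cutoff e x * partial k G x)).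
    by apply: continuousM => //; exact: continuous_dcutoff.
  by apply: continuousM => //; exact: continuous_cutoff.
rewrite /prop_for /continuous_at dF0.
pose c := (6 * C + D) * e^-1 ^+ 3.
have cc : continuous (fun x : 'rV[R]_m => c * (euclid x * euclid x)).
  do 2![apply: continuous_funM; [first [exact: cst_continuous|exact: continuous_euclid]|]].
  exact: continuous_euclid.
have {cc} : c * (euclid x * euclid x) @[x --> (0 : 'rV[R]_m)] --> (0 : R).
  by have := cc 0; rewrite /continuous_at euclid0 !mulr0.
apply: (@squeeze_norm_cvg0 _ _ _ (nbhs_filter (0 : 'rV[R]_m))) => y.
by rewrite -expr2 dF_le.
Qed.

Lemma integral_regularized :
  (\int[mu]_(x in B) (dF x)%:E = 0)%E.
Proof.
have pF : partial k F = dF by apply/funext => x; case: (F_derive x).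
have H := @integral_partial_eq0 R m k F 1 (fun x => (F_derive x).1).
rewrite pF in H.
have F1 x : (exists i : 'I_m, 1 < `|x ord0 i|) -> F x = 0.
  move=> [i xi]; rewrite /F GB ?mulr0// => Bx.
  by have := le_lt_trans (abs_coord_le_euclid x i) Bx; lra.
transitivity (\int[mu]_x (dF x)%:E)%E; last by apply: H => //; exact: dF_cont.
rewrite [LHS]integral_mkcond; apply: eq_integral => x _.
rewrite /patch; case: ifPn => //; rewrite notin_setE => Bx.
by rewrite /dF GB// GB'// !mulr0 addr0.
Qed.
End regularized.


Hypothesis m5 : (4 < m)%N.

(** With r > 0 fixed and e -> 0, the cutoff tends to 1 and its gradient, which carries a factor e,
    tends to 0. *)
Lemma regularized_cvg f g k x : x != 0 ->
  dcutoff n.+1%:R^-1 k x * f x + cutoff n.+1%:R^-1 x * g x @[n --> \oo] --> g x.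
Proof.
move=> x0; have r2 : euclid x ^+ 2 != 0 by rewrite sqrf_eq0 euclid_eq0.
have ca : (n.+1%:R^-1 : R) @[n --> \oo] --> (0 : R) by exact: cvg_harmonic.
have cw : (euclid x ^+ 2 + n.+1%:R^-1)^-1 @[n --> \oo] --> (euclid x ^+ 2)^-1.
  by apply: cvgV => //; rewrite -[X in _ --> X]addr0; apply: cvgD => //; exact: cvg_cst.
set w : nat -> R := fun n => (euclid x ^+ 2 + n.+1%:R^-1)^-1 in cw.
have cb : cutbase n.+1%:R^-1 x @[n --> \oo] --> (1 : R).
  rewrite -[X in _ --> X]subr0 -[X in _ - X](mul0r (euclid x ^+ 2)^-1).
  by apply: cvgB; [exact: cvg_cst|exact: cvgM].
have cb3 : cutoff n.+1%:R^-1 x @[n --> \oo] --> (1 : R).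
  rewrite -[X in _ --> X](expr1n _ 3).
  exact: (@continuous_cvg _ _ _ _ _ _ (fun t : R => t ^+ 3) _ (@exprn_continuous R 3 1) cb).
have cb2 : cutbase n.+1%:R^-1 x ^+ 2 @[n --> \oo] --> (1 : R).
  rewrite -[X in _ --> X](expr1n _ 2).
  exact: (@continuous_cvg _ _ _ _ _ _ (fun t : R => t ^+ 2) _ (@exprn_continuous R 2 1) cb).
have cw2 : w n ^+ 2 @[n --> \oo] --> (euclid x ^+ 2)^-1 ^+ 2.
  exact: (@continuous_cvg _ _ _ _ _ _ (fun t : R => t ^+ 2) _ (@exprn_continuous R 2 _) cw).
have cd : dcutoff n.+1%:R^-1 k x @[n --> \oo] --> (0 : R).
  rewrite (_ : 0 = 3 * 1 * (0 * (2 * x ord0 k) * (euclid x ^+ 2)^-1 ^+ 2)); last first.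
    by rewrite !mul0r mulr0.
  apply: cvgM; first by apply: cvgM => //; exact: cvg_cst.
  by apply: cvgM => //; apply: cvgM => //; exact: cvg_cst.
rewrite [X in _ --> X](_ : g x = 0 * f x + 1 * g x); last by rewrite mul0r add0r mul1r.
by apply: cvgD; apply: cvgM => //; exact: cvg_cst.
Qed.

(** Dominated convergence as e = 1/(n+1) tends to 0. The majorant (6 C + D) r^-4 adds the uniform
    gradient bound 6/r times C r^-3 to the bound D r^-4 for the derivative of G. *)
Lemma integral_sing_partial (G : 'rV[R]_m -> R) k : sing 3 G ->
  (forall x, ~ B x -> G x = 0) -> (forall x, ~ B x -> partial k G x = 0) ->
  (\int[mu]_(x in B) (partial k G x)%:E = 0)%E.
Proof.
move=> sG GB GB'.
have [C [C0 HC]] := sing_bound sG.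
have [D [D0 HD]] := sing_bound (sing_partial k sG).
have r0 x n : 0 <= rinv x ^+ n by rewrite exprn_ge0 ?rinv_ge0.
have GC x : x != 0 -> `|G x| <= C * rinv x ^+ 3.
  by move=> x0; have [/HC|/GB ->] := pselect (B x); [exact|rewrite normr0 mulr_ge0].
have GD x : x != 0 -> `|partial k G x| <= D * rinv x ^+ 4.
  by move=> x0; have [/HD|/GB' ->] := pselect (B x); [exact|rewrite normr0 mulr_ge0].
have e0 n : 0 < n.+1%:R^-1 :> R by rewrite invr_gt0.
pose f_ n x : \bar R := (dcutoff n.+1%:R^-1 k x * G x + cutoff n.+1%:R^-1 x * partial k G x)%:E.
have mB : measurable B by exact: measurable_unit_ball.
have m0 : measurable [set (0 : 'rV[R]_m)] by exact: measurable_set0.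
have off0 (P : 'rV[R]_m -> Prop) : (forall x, x != 0 -> P x) -> {ae mu, forall x, P x}.
  move=> HP; exists [set 0]; split => //; first exact: lebesgue_origin.
  by move=> x /=; apply: contra_notP => /eqP /HP.
have H : ((\int[mu]_(x in B) f_ n x) @[n --> \oo] --> \int[mu]_(x in B) (partial k G x)%:E)%E.
  case: (@dominated_convergence _ _ _ mu B mB f_ (fun x => (partial k G x)%:E)
    (fun x => ((6 * C + D) * rinv x ^+ 4)%:E)) => [|||||_ _ //].
  - move=> n; apply/measurable_EFinP; apply: measurable_funTS; apply: measurable_funD.
      apply: measurable_funM; last exact: sing_measurable sG.
      by apply: measurable_fun_rV_continuous; exact: continuous_dcutoff.
    apply: measurable_funM; last exact: (sing_measurable (sing_partial k sG)).
    by apply: measurable_fun_rV_continuous; exact: continuous_cutoff.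
  - apply/measurable_EFinP; apply: measurable_funTS.
    exact: (sing_measurable (sing_partial k sG)).
  - apply: off0 => x x0 _; apply/fine_cvgP; split; first by near=> n.
    exact: regularized_cvg.
  - rewrite (_ : (fun x => _) = (fun x => (6 * C + D)%:E * (rinv x ^+ 4)%:E)%E)//.
    by apply: integrableZl => //; exact: integrable_rinv4.
  - apply: off0 => x x0 n _; rewrite lee_fin.
    apply: (le_trans (ler_normD _ _)).
    rewrite (normrM (dcutoff _ k x)) (normrM (cutoff _ x)).
    rewrite (ger0_norm (cutoff_ge0 (e0 n) _)) mulrDl.
    apply: lerD; last by rewrite -[leRHS]mul1r ler_pM ?cutoff_ge0 ?cutoff_le1 ?GD.
    rewrite (_ : 6 * C * _ = (6 * rinv x) * (C * rinv x ^+ 3)); last by ring.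
    by apply: ler_pM => //; [exact: dcutoff_le_rinv|exact: GC].
have H0 n : (\int[mu]_(x in B) f_ n x = 0)%E.
  exact: (@integral_regularized G k C D n.+1%:R^-1).
apply: (cvg_unique _ H); first exact: ereal_hausdorff.
by rewrite /= (eq_cvg _ _ H0); exact: cvg_cst.
Unshelve. all: by end_near. Qed.

(** The derivative of f * phi has integral 0; the bound n <= 3 keeps the derivative of f within the
    integrable range r^-4. *)
Lemma sing_by_parts n f phi k : (n <= 3)%N -> sing n f -> test_function phi ->
  \int[mu]_(x in B) (f x * partial k phi x) =
  - \int[mu]_(x in B) (partial k f x * phi x).
Proof.
move=> n3 sf tphi; have mB : measurable B by exact: measurable_unit_ball.
have tdphi := test_function_partial k tphi.
have sfp : sing 3 (fun x => f x * phi x).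
  by apply: (sing_le n3); rewrite -[n]addn0; apply: (singM sf); exact: sing_test.
have sfdp : sing 4 (fun x => f x * partial k phi x).
  apply: (sing_le (n := n)); first exact: leqW.
  by rewrite -[n]addn0; apply: (singM sf); exact: sing_test.
have sdfp : sing 4 (fun x => partial k f x * phi x).
  apply: (sing_le (n := n.+1)) => //.
  by rewrite -[n.+1]addn0; apply: (singM (sing_partial k sf)); exact: sing_test.
have i1 := sing_integrable m5 (leqnn 4) sfdp.
have i2 := sing_integrable m5 (leqnn 4) sdfp.
have tout x : ~ B x -> partial k phi x = 0 by exact: test_function_out.
have pfp x : x != 0 -> partial k (fun x => f x * phi x) x =
    f x * partial k phi x + partial k f x * phi x.
  move=> x0; rewrite partialM 1?addrC//; first exact: (sing_pderivable sf).
  apply: differentiable_pderivable; apply: smooth_differentiable; exact: test_function_smooth.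
have m1 : measurable_fun setT (fun x => f x * partial k phi x + partial k f x * phi x).
  by apply: measurable_funD; [exact: sing_measurable sfdp|exact: sing_measurable sdfp].
apply/eqP; rewrite -addr_eq0 -RintegralD// /Rintegral.
(* The product rule is available only off the origin, a null set. *)
rewrite (ae_eq_integral (fun x => (partial k (fun x => f x * phi x) x)%:E))//.
- rewrite integral_sing_partial// => x Bx; first by rewrite (test_function_out tphi)// mulr0.
  have [_ cphi phiB] := tphi.
  have xs : ~ closure [set x | phi x != 0] x by move=> /phiB.
  rewrite (@eq_partial _ _ _ _ (fun=> 0)) ?partial_cst//.
  by apply: filterS (notin_support_near xs) => y ->; rewrite mulr0.
- by apply/measurable_EFinP; exact: measurable_funTS.
- apply/measurable_EFinP; apply: measurable_funTS.
  exact: (sing_measurable (sing_partial k sfp)).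
- exists [set 0]; split; [exact: measurable_set0|exact: lebesgue_origin|].
  by move=> x /=; apply: contra_notP => /eqP x0 _; rewrite pfp.
Qed.

End by_parts.

(** * Smooth bumps *)

Section flat_functions.
Context {R : realType}.
Implicit Types (t : R) (j : nat).

(* The functions t^-j exp(-1/t), extended by 0, are closed under derivation up
   to linear combinations. *)
Definition flat j t : R := if 0 < t then t^-1 ^+ j * expR (- t^-1) else 0.

Lemma flat_ge0 j t : 0 <= flat j t.
Proof.
rewrite /flat; case: ifPn => // t0.
by rewrite mulr_ge0 ?expR_ge0 ?exprn_ge0// invr_ge0 ltW.
Qed.

Lemma flat0_le1 t : flat 0 t <= 1.
Proof.
rewrite /flat; case: ifPn => // t0; rewrite expr0 mul1r expR_le1.
by rewrite oppr_le0 invr_ge0 ltW.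
Qed.

(** One term of the exponential series: t^-(j+2) / (j+2)! <= exp(1/t). A quadratic bound is what
    forces derivative 0 at the origin. *)
Lemma flat_le_sqr j t : flat j t <= j.+2`!%:R * t ^+ 2.
Proof.
rewrite /flat; case: ifPn => [t0|_]; last by rewrite mulr_ge0 ?sqr_ge0.
have u0 : 0 <= t^-1 by rewrite invr_ge0 ltW.
have f0 : 0 < j.+2`!%:R :> R by rewrite ltr0n fact_gt0.
rewrite expRN ler_pdivrMr ?expR_gt0//.
have := expR_ge1Dxn j.+1 u0.
move=> /(le_trans (_ : t^-1 ^+ j.+2 / j.+2`!%:R <= _)) H.
have {}H : t^-1 ^+ j.+2 / j.+2`!%:R <= expR t^-1 by apply: H; rewrite lerDr.
apply: (@le_trans _ _ (j.+2`!%:R * t ^+ 2 * (t^-1 ^+ j.+2 / j.+2`!%:R))).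
  have -> : t^-1 ^+ j.+2 = t^-1 ^+ j * t^-1 ^+ 2 by rewrite -exprD addn2.
  rewrite le_eqVlt; apply/orP; left; apply/eqP; set q := t^-1 ^+ j.
  by field; rewrite (gt_eqF t0) (gt_eqF f0).
by rewrite ler_wpM2l// mulr_ge0 ?sqr_ge0.
Qed.

Lemma is_derive_flat j t : is_derive t 1 (flat j) (flat j.+2 t - j%:R * flat j.+1 t).
Proof.
have [t0|t0|->] := ltgtP t 0.
- apply: (@near_eq_is_derive _ _ _ (cst 0)); last first.
    rewrite /flat (lt_gtF t0) mulr0 subr0; exact: is_derive_cst.
  by near=> s; rewrite /flat; case: ifPn => // s0; exfalso; move: s0; apply/negP;
    rewrite -leNgt ltW//; near: s; exact: lt_nbhsl.
- apply: (@near_eq_is_derive R R R (fun s : R => s^-1 ^+ j * expR (- s^-1)) (flat j) t 1).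
    by near=> s; rewrite /flat ifT//; near: s; exact: lt_nbhsr.
  have tn0 : t != 0 by rewrite gt_eqF.
  have dv : is_derive t 1 (fun s : R => s^-1) (- t ^- 2).
    split; first by apply/derivable1_diffP; exact: differentiable_Rinv.
    rewrite deriveE; last exact: differentiable_Rinv.
    by rewrite diff_Rinv// /GRing.scale/= mulr1.
  have de : is_derive t 1 (fun s : R => expR (- s^-1)) (expR (- t^-1) * t ^- 2).
    apply: (@is_derive1_comp _ expR (fun s : R => - s^-1)).
    by rewrite -[X in is_derive _ _ _ X]opprK; exact: is_deriveN.
  have dx : is_derive t 1 (fun s : R => s^-1 ^+ j) (- (j%:R * t^-1 ^+ j.+1)).
    case: (j) => [|i].
      by under eq_fun do rewrite expr0; rewrite mul0r oppr0; exact: is_derive_cst.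
    have dp : is_derive (t^-1) 1 (fun u : R => u ^+ i.+1) (i.+1%:R * t^-1 ^+ i).
      by split; [exact: exprn_derivable|rewrite exp_derive scaler1].
    rewrite (_ : - _ = i.+1%:R * t^-1 ^+ i * - t ^- 2).
      exact: (@is_derive1_comp _ (fun u : R => u ^+ i.+1) (fun s : R => s^-1)).
    by rewrite -exprVn -(addn2 i) exprD; ring.
  rewrite (_ : flat j.+2 t - _ = t^-1 ^+ j *: (expR (- t^-1) * t ^- 2) +
    expR (- t^-1) *: - (j%:R * t^-1 ^+ j.+1)); first exact: is_deriveM.
  by rewrite /flat t0 /GRing.scale/= -exprVn -addn2 exprD -addn1 exprD; ring.
(* At t = 0 the quadratic bound makes the difference quotient tend to 0. *)
- rewrite /flat ltxx mulr0 subr0.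
  have H : h^-1 *: ((flat j \o shift 0) (h *: (1 : R)) - flat j 0) @[h --> 0^'] --> (0 : R).
    apply/cvgr0Pnorm_le => e e0.
    near=> h; have h0 : h != 0 by near: h; exact: nbhs_dnbhs_neq.
    rewrite /flat ltxx subr0 /= addr0 [_%:A]mulr1 -/(flat j h).
    rewrite [X in X <= _]normrM normfV ler_pdivrMl ?normr_gt0//.
    rewrite ger0_norm ?flat_ge0//; apply: le_trans (flat_le_sqr _ _) _.
    have f0 : 0 < j.+2`!%:R :> R by rewrite ltr0n fact_gt0.
    have h2 : `|h| <= e / j.+2`!%:R by near: h; apply: dnbhs0_le; rewrite divr_gt0.
    rewrite -real_normK ?num_real// expr2 mulrCA ler_wpM2l//.
    by rewrite mulrC -ler_pdivlMr.
  split; first by apply/cvg_ex; exists 0.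
  exact/cvg_lim.
Unshelve. all: by end_near. Qed.

(** Here exp(-1/((n+1) t)) tends to 1, so stretched copies of [flat 0] approximate the indicator of
    the positive half-line. *)
Lemma flat0_cvg1 t : 0 < t -> flat 0 (n.+1%:R * t) @[n --> \oo] --> (1 : R).
Proof.
move=> t0.
have -> : (fun n => flat 0 (n.+1%:R * t)) = fun n => expR (- (n.+1%:R^-1 * t^-1)).
  by apply/funext => n; rewrite /flat pmulr_rgt0// t0 expr0 mul1r invfM.
have H : - (n.+1%:R^-1 * t^-1) @[n --> \oo] --> - (0 * t^-1).
  by apply: cvgN; apply: cvgM; [exact: cvg_harmonic|exact: cvg_cst].
rewrite [X in _ --> X](_ : 1 = expR (- (0 * t^-1))); last by rewrite mul0r oppr0 expR0.
exact: (@continuous_cvg _ _ _ _ _ _ expR _ (@continuous_expR R _) H).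
Qed.

End flat_functions.

(** * Smooth approximations of indicators of boxes *)

Section box_bumps.
Context {R : realType} {m : nat}.
Implicit Types (x : 'rV[R]_m) (a b : 'I_m -> R) (k i : 'I_m).
Local Notation mu := (@lebesgue_rV R m).
Local Notation B := (@unit_ball R m).

(** An algebra containing the box bumps and closed under partial derivatives, as [smooth_class]
    demands. *)
Inductive flat_class : ('rV[R]_m -> R) -> Prop :=
| flat_class_cst (c : R) : flat_class (fun=> c)
| flat_class_flat j (c d : R) i : flat_class (fun x => flat j (c * x ord0 i + d))
| flat_classD f g : flat_class f -> flat_class g -> flat_class (fun x => f x + g x)
| flat_classM f g : flat_class f -> flat_class g -> flat_class (fun x => f x * g x).

Lemma differentiable_flat_coord j (c d : R) i x :
  differentiable (fun x => flat j (c * x ord0 i + d)) x.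
Proof.
apply: (@differentiable_comp _ _ _ _ (fun x : 'rV[R]_m => c * x ord0 i + d) (flat j)).
  apply: differentiableD => //; apply: differentiableM => //.
  exact: differentiable_coord.
by apply/derivable1_diffP; have [] := is_derive_flat j (c * x ord0 i + d).
Qed.

Lemma partial_flat_coord k j (c d : R) i x :
  partial k (fun x => flat j (c * x ord0 i + d)) x =
  (c * (i == k)%:R) * (flat j.+2 (c * x ord0 i + d) + (- j%:R) * flat j.+1 (c * x ord0 i + d)).
Proof.
pose t := c * x ord0 i + d.
have H h : flat j (c * (h *: delta_mx ord0 k + x) ord0 i + d) = flat j (h *: (c * (i == k)%:R) + t).
  by rewrite /t !mxE eqxx /GRing.scale/=; congr (flat j _); ring.
have [_ E] := @eq_along_derive R _ _ (fun x : 'rV[R]_m => flat j (c * x ord0 i + d))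
  (flat j) _ _ _ _ H.
rewrite /partial {}E.
rewrite -[X in 'D_X _ _]mulr1.
have [df dE] := is_derive_flat j t.
rewrite deriveE; last exact/derivable1_diffP.
have -> : (c * (i == k)%:R * 1 : R) = (c * (i == k)%:R) *: (1 : R) by [].
rewrite linearZ -deriveE; last exact/derivable1_diffP.
by rewrite dE /GRing.scale/= mulNr.
Qed.

Lemma flat_class_partial f : flat_class f ->
  (forall x, differentiable f x) /\ forall k, flat_class (partial k f).
Proof.
elim=> {f} [c|j c d i|f g Pf [df IHf] Pg [dg IHg]|f g Pf [df IHf] Pg [dg IHg]].
- split=> [x|k]; first exact: differentiable_cst.
  rewrite (_ : partial k _ = fun=> 0); first exact: flat_class_cst.
  by apply/funext => x; rewrite partial_cst.
- split=> [x|k]; first exact: differentiable_flat_coord.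
  rewrite (_ : partial k _ = fun x => (c * (i == k)%:R) *
    (flat j.+2 (c * x ord0 i + d) + (- j%:R) * flat j.+1 (c * x ord0 i + d))).
    apply: flat_classM; first exact: flat_class_cst.
    apply: flat_classD; first exact: flat_class_flat.
    by apply: flat_classM; [exact: flat_class_cst|exact: flat_class_flat].
  by apply/funext => x; rewrite partial_flat_coord.
- split=> [x|k]; first exact: differentiableD.
  rewrite (_ : partial k _ = fun x => partial k f x + partial k g x).
    exact: flat_classD.
  by apply/funext => x; rewrite partialD//; exact: differentiable_pderivable.
- split=> [x|k]; first exact: differentiableM.
  rewrite (_ : partial k _ = fun x => partial k f x * g x + f x * partial k g x).
    by apply: flat_classD; exact: flat_classM.
  by apply/funext => x; rewrite partialM//; exact: differentiable_pderivable.
Qed.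

(** Values in [0, 1], zero outside the open box, and pointwise convergence to 1 inside it as n
    grows; each face contributes one stretched [flat 0]. *)
Definition box_bump a b (n : nat) x : R :=
  \prod_(i < m) (flat 0 (n.+1%:R * (x ord0 i - a i)) * flat 0 (n.+1%:R * (b i - x ord0 i))).

Lemma smooth_box_bump a b n : smooth (box_bump a b n).
Proof.
apply: (smooth_class flat_class_partial); rewrite /box_bump.
elim: (index_enum _) => [|i r IHr].
  by under eq_fun do rewrite big_nil; exact: flat_class_cst.
under eq_fun do rewrite big_cons; apply: flat_classM => //.
rewrite (_ : (fun x => _) = fun x => flat 0 (n.+1%:R * x ord0 i + (- n.+1%:R * a i)) *
    flat 0 (- n.+1%:R * x ord0 i + n.+1%:R * b i)); last first.
  by apply/funext => x; congr (flat 0 _ * flat 0 _); ring.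
by apply: flat_classM; exact: flat_class_flat.
Qed.

Lemma box_bump_ge0 a b n x : 0 <= box_bump a b n x.
Proof. by apply: prodr_ge0 => i _; rewrite mulr_ge0 ?flat_ge0. Qed.

Lemma box_bump_le1 a b n x : box_bump a b n x <= 1.
Proof.
apply: prodr_ile1 => i _; rewrite mulr_ge0 ?flat_ge0//=.
by rewrite mulr_ile1 ?flat_ge0 ?flat0_le1.
Qed.

Lemma box_bump_out a b n x : ~ obox a b x -> box_bump a b n x = 0.
Proof.
move=> /existsNP[i]; rewrite in_itv/= => /negP xi; rewrite /box_bump (bigD1 i)//=.
suff -> : flat 0 (n.+1%:R * (x ord0 i - a i)) * flat 0 (n.+1%:R * (b i - x ord0 i)) = 0.
  by rewrite mul0r.
move: xi; rewrite negb_and -!leNgt => /orP[xi|xi]; apply/eqP; rewrite mulf_eq0 /flat.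
  by rewrite pmulr_rgt0// subr_gt0 ltNge xi eqxx.
by rewrite !pmulr_rgt0// !subr_gt0 [x ord0 i < b i]ltNge xi eqxx orbT.
Qed.

Lemma box_bump_cvg a b x : obox a b x -> box_bump a b n x @[n --> \oo] --> (1 : R).
Proof.
move=> abx; rewrite /box_bump; elim: (index_enum _) => [|i r IHr].
  by under eq_fun do rewrite big_nil; exact: cvg_cst.
under eq_fun do rewrite big_cons.
have := abx i; rewrite in_itv/= => /andP[ax xb].
suff : flat 0 (n.+1%:R * (x ord0 i - a i)) * flat 0 (n.+1%:R * (b i - x ord0 i)) *
  \prod_(j <- r) (flat 0 (n.+1%:R * (x ord0 j - a j)) * flat 0 (n.+1%:R * (b j - x ord0 j)))
    @[n --> \oo] --> (1 * 1 * 1 : R) by rewrite !mulr1.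
apply: cvgM => //.
by apply: cvgM; apply: flat0_cvg1; rewrite subr_gt0.
Qed.

Lemma closed_cbox a b : closed (cbox a b).
Proof. by apply: compact_closed; [exact: norm_hausdorff|exact: compact_cbox]. Qed.

Lemma test_function_box_bump a b n : cbox a b `<=` B -> test_function (box_bump a b n).
Proof.
move=> abB.
have sub : closure [set x | box_bump a b n x != 0] `<=` cbox a b.
  rewrite [X in _ `<=` X](closure_id _).1; last exact: closed_cbox.
  apply: closure_subset => x /= /eqP bx; apply: sub_obox_cbox.
  by apply: contra_notP bx; exact: box_bump_out.
split; [exact: smooth_box_bump| |exact: subset_trans sub abB].
by apply: subclosed_compact sub; [exact: closed_closure|exact: compact_cbox].
Qed.

End box_bumps.

(** * The du Bois-Reymond lemma *)

Section du_bois_reymond.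
Context {R : realType} {m : nat}.
Implicit Types (x : 'rV[R]_m) (a b : 'I_m -> R) (f g phi : 'rV[R]_m -> R).
Local Notation mu := (@lebesgue_rV R m).
Local Notation B := (@unit_ball R m).

Lemma integrable_bounded_mul (D : set 'rV[R]_m) f phi (C : R) :
  measurable D -> mu.-integrable D (EFin \o f) -> measurable_fun D phi ->
  (forall x, D x -> `|phi x| <= C) ->
  mu.-integrable D (fun x => (f x * phi x)%:E).
Proof.
move=> mD iF mphi phiC.
apply: (@le_integrable _ _ _ mu D mD _ (fun x => C%:E * (EFin \o f) x)%E).
- apply/measurable_EFinP; apply: measurable_funM => //.
  by have /measurable_EFinP := measurable_int _ iF.
- move=> x Dx /=; rewrite lee_fin !normrM mulrC ler_wpM2r//.
  by rewrite (le_trans (phiC _ Dx))// ler_norm.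
- exact: integrableZl.
Qed.

Lemma integral_support (D E : set 'rV[R]_m) (f : 'rV[R]_m -> \bar R) :
  D `<=` E -> (forall x, ~ D x -> f x = 0%E) ->
  (\int[mu]_(x in E) f x = \int[mu]_(x in D) f x)%E.
Proof.
move=> DE f0; rewrite integral_mkcond [RHS]integral_mkcond; congr integral.
apply/funext => x; rewrite /patch; case: ifPn; case: ifPn => //.
- by rewrite notin_setE => /f0.
- by rewrite inE => /DE Ex; rewrite notin_setE.
Qed.

Lemma integrable_support (D E : set 'rV[R]_m) (f : 'rV[R]_m -> \bar R) :
  measurable D -> measurable E -> D `<=` E -> (forall x, ~ D x -> f x = 0%E) ->
  mu.-integrable D f -> mu.-integrable E f.
Proof.
move=> mD mE DE f0 /(integrable_mkcond _ mD) iD; apply/(integrable_mkcond _ mE).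
rewrite (_ : f \_ E = f \_ D)//.
apply/funext => x; rewrite /patch; case: ifPn; case: ifPn => //.
- by rewrite notin_setE => /f0.
- by rewrite inE => /DE Ex; rewrite notin_setE.
Qed.

Lemma integrable_loc_test f phi : loc_integrable f -> test_function phi ->
  mu.-integrable B (fun x => (f x * phi x)%:E).
Proof.
move=> lf tphi; have [sphi cphi phiB] := tphi.
have [C [C0 phiC]] := test_function_bounded tphi.
have mK := measurable_compact cphi.
apply: (integrable_support mK) => //.
- exact: measurable_unit_ball.
- move=> x Kx; rewrite (_ : phi x = 0) ?mulr0//.
  exact: nbhs_singleton (notin_support_near Kx).
- apply: (@integrable_bounded_mul _ _ _ C) => //; first exact: lf.
  apply: measurable_funTS; apply: measurable_fun_rV_continuous.
  exact: smooth_continuous.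
Qed.

Section vanishing.
Variable g : 'rV[R]_m -> R.
Hypothesis lg : loc_integrable g.
Hypothesis g0 : forall phi, test_function phi -> \int[mu]_(x in B) (g x * phi x) = 0.

(** The bumps are test functions tending to the indicator of the open box, and |g|, integrable on
    the compact closed box, dominates. *)
Lemma integral_obox_eq0 a b : cbox a b `<=` B ->
  (\int[mu]_(x in obox a b) (g x)%:E = 0)%E.
Proof.
move=> abB; have cK := @compact_cbox R m a b.
have iK : mu.-integrable (cbox a b) (EFin \o g) by exact: lg.
have mK : measurable (cbox a b) by exact: measurable_cbox.
have mg : measurable_fun (cbox a b) g by apply/measurable_EFinP; exact: measurable_int iK.
pose f_ n x : \bar R := (g x * box_bump a b n x)%:E.
pose f x : \bar R := (g x * \1_(obox a b) x)%:E.
have H : ((\int[mu]_(x in cbox a b) f_ n x) @[n --> \oo] --> \int[mu]_(x in cbox a b) f x)%E.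
  case: (@dominated_convergence _ _ _ mu _ mK f_ f (abse \o (EFin \o g))) => [|||||_ _ //].
  - move=> n; apply/measurable_EFinP; apply: measurable_funM => //.
    apply: measurable_funTS; apply: measurable_fun_rV_continuous.
    exact/smooth_continuous/smooth_box_bump.
  - apply/measurable_EFinP; apply: measurable_funM => //.
    by apply: measurable_indic; exact: measurable_obox.
  - apply: aeW => x _; apply/fine_cvgP; split; first by near=> n.
    apply: cvgM; first exact: cvg_cst.
    rewrite indicE; have [ox|ox] := pselect (obox a b x).
      by rewrite mem_set//; exact: box_bump_cvg.
    rewrite memNset//; have -> : (box_bump a b)^~ x = fun=> 0.
      by apply/funext => n; exact: box_bump_out.
    exact: cvg_cst.
  - exact: integrable_abse.
  - apply: aeW => x n _ /=; rewrite lee_fin normrM ler_piMr//.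
    by rewrite ger0_norm ?box_bump_ge0 ?box_bump_le1.
have H0 n : (\int[mu]_(x in cbox a b) f_ n x = 0)%E.
  have tb := test_function_box_bump n abB.
  have iB := integrable_loc_test lg tb.
  have := g0 tb; rewrite /Rintegral => h.
  have f0 x : ~ cbox a b x -> f_ n x = 0%E.
    move=> /= nx; rewrite /f_ box_bump_out ?mulr0//.
    by apply: contra_not nx; exact: sub_obox_cbox.
  rewrite -(integral_support abB f0) -[LHS]fineK ?h//.
  by apply: integrable_fin_num => //; exact: measurable_unit_ball.
have f0 x : ~ obox a b x -> f x = 0%E.
  by move=> ox; rewrite /f indicE memNset// mulr0.
transitivity (\int[mu]_(x in obox a b) f x)%E.
  by apply: eq_integral => x; rewrite /f inE => ox; rewrite indicE mem_set// mulr1.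
rewrite -(integral_support (@sub_obox_cbox _ _ a b) f0).
apply: (cvg_unique _ H); first exact: ereal_hausdorff.
by rewrite /= (eq_cvg _ _ H0); exact: cvg_cst.
Unshelve. all: by end_near. Qed.

Lemma oboxI a b (c d : 'I_m -> R) : obox a b `&` obox c d =
  obox (fun i => Num.max (a i) (c i)) (fun i => Num.min (b i) (d i)).
Proof.
apply/seteqP; split => [x [ab cd] i|x h].
  have := ab i; have := cd i; rewrite !in_itv/= => /andP[? ?] /andP[? ?].
  by rewrite gt_max lt_min; apply/andP; split; apply/andP.
split => i; have := h i; rewrite !in_itv/= gt_max lt_min;
  by move=> /andP[/andP[? ?] /andP[? ?]]; apply/andP.
Qed.

Definition oboxes : set (set 'rV[R]_m) := [set A | exists a b, A = obox a b].

(** Together with stability under intersection, this makes the open boxes a generating pi-system for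
    Dynkin induction. *)
Lemma measurable_oboxes : @measurable _ 'rV[R]_m = <<s oboxes >>.
Proof.
apply/seteqP; split; last first.
  apply: smallest_sub; first exact: sigma_algebra_measurable.
  by move=> _ [a [b ->]]; exact: measurable_obox.
apply: smallest_sub; first exact: smallest_sigma_algebra.
move=> _ [i [Y [mY ->]]].
have mi : measurable_fun setT
    (fun x : g_sigma_algebraType oboxes => (x : 'rV[R]_m) ord0 i : R).
  apply: (measurability _ (RGenOpens.measurableE R)).
  move=> _ [_ [u [v ->]] <-]; rewrite setTI.
  (* A slab u < x_i < v is the union over n of boxes bounded by -n and n in the other
     coordinates. *)
  rewrite (_ : _ @^-1` _ = \bigcup_n (obox (fun j => if j == i then u else - n%:R)
     (fun j => if j == i then v else n%:R) : set (g_sigma_algebraType oboxes))).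
    apply: bigcupT_measurable => n; apply: sub_sigma_algebra.
    by eexists; eexists; reflexivity.
  apply/seteqP; split => [x xi|x [n _ /(_ i)]]; last by rewrite eqxx.
  have [n xn] : exists n : nat, forall j, `|(x : 'rV[R]_m) ord0 j| < n%:R.
    exists (Num.truncn (`|(x : 'rV[R]_m)|)).+1 => j.
    apply: le_lt_trans (truncnS_gt _).
    rewrite [leRHS]/Num.norm/= mx_normrE; apply/bigmax_geP; right => /=.
    by exists (ord0, j).
  exists n => // j; case: eqP => [->//|_].
  by have := xn j; rewrite in_itv/= ltr_norml.
by have := mi measurableT Y mY; rewrite setTI.
Qed.

(** The sets S for which g integrates to 0 over S [&] Q form a Dynkin class containing the boxes. So
    g integrates to 0 over every measurable subset of Q and vanishes almost everywhere there. *)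
Lemma ae_eq0_obox a b : cbox a b `<=` B ->
  {ae mu, forall x, obox a b x -> g x = 0}.
Proof.
move=> abB; set Q := obox a b.
have mQ : measurable Q by exact: measurable_obox.
have iQ : mu.-integrable Q (EFin \o g).
  apply: integrableS (lg (@compact_cbox R m a b) abB) => //; first exact: measurable_cbox.
  exact: sub_obox_cbox.
have iQS S : measurable S -> mu.-integrable (S `&` Q) (EFin \o g).
  move=> mS; have mSQ := measurableI _ _ mS mQ.
  by apply: integrableS iQ => //; exact: subIsetr.
have finQS S : measurable S -> (\int[mu]_(x in S `&` Q) (EFin \o g) x)%E \is a fin_num.
  by move=> mS; apply: integrable_fin_num => //; [exact: measurableI|exact: iQS].
have PQ S : measurable S -> (\int[mu]_(x in S `&` Q) (EFin \o g) x = 0)%E.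
  rewrite measurable_oboxes; move: S.
  apply: (@dynkin_induction _ _ oboxes
    (fun S => (\int[mu]_(x in S `&` Q) (EFin \o g) x = 0)%E) measurable_oboxes).
  - by move=> _ _ [a1 [b1 ->]] [a2 [b2 ->]]; rewrite oboxI; eexists; eexists; reflexivity.
  - by rewrite setTI; exact: integral_obox_eq0.
  - move=> _ [c [d ->]]; rewrite /= /Q oboxI; apply: integral_obox_eq0.
    apply: subset_trans abB => x xi i; have := xi i; rewrite !in_itv/= ge_max le_min.
    by move=> /andP[/andP[_ ->] /andP[_ ->]].
  - move=> S mS S0.
    have := @Rintegral_setU _ _ _ mu (S `&` Q) (~` S `&` Q) g.
    rewrite -setIUl setUv setTI /Rintegral S0 integral_obox_eq0//= add0r => h.
    rewrite -[LHS]fineK; last by apply: finQS; exact: measurableC.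
    rewrite -h//.
    + exact: measurableI.
    + by apply: measurableI => //; exact: measurableC.
    + by apply/disj_setPS => x [[Sx _] [nSx _]].
  - move=> F mF tF F0; rewrite setI_bigcupl integral_bigcup.
    + by rewrite eseries0.
    + exact: trivIset_setIr.
    + by move=> k; exact: measurableI.
    + by rewrite -setI_bigcupl; apply: iQS; exact: bigcupT_measurable.
have := @integral_ae_eq _ _ _ mu Q mQ (cst 0%E) (EFin \o g) iQ (measurable_cst _).
move=> h; have {}h : ae_eq mu Q (EFin \o g) (cst 0%E).
  apply: h => E EQ mE; rewrite integral0.
  by rewrite -[in LHS](setIidl EQ); exact: PQ.
by apply: filterS h => x h Qx; have [] := h Qx.
Qed.

(** Countably many rational boxes, enumerated by [unpickle], cover the ball with closures inside it,
    and each meets the exceptional set in a null set. *)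
Lemma ae_eq0_unit_ball : {ae mu, forall x, B x -> g x = 0}.
Proof.
pose bad (n : nat) : set 'rV[R]_m :=
  if @unpickle ({ffun 'I_m -> rat} * nat)%type n is Some q then
    [set x | cbox (ratlo q.1 q.2) (rathi q.1 q.2) `<=` B /\
             obox (ratlo q.1 q.2) (rathi q.1 q.2) x /\ g x <> 0] else set0.
apply: (@negligibleS _ _ _ _ (\bigcup_n bad n)).
  move=> x /= /not_implyP[Bx gx].
  have [p [k [px pB]]] := open_ratbox (@open_unit_ball R m) Bx.
  by exists (pickle (p, k)) => //; rewrite /bad pickleK.
apply: negligible_bigcup => n; rewrite /bad.
case: unpickle => [q|]; last exact: negligible_set0.
have [qB|qB] := pselect (cbox (@ratlo R m q.1 q.2) (rathi q.1 q.2) `<=` B).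
  apply: negligibleS (ae_eq0_obox qB) => x [_ [qx gx]] /= h; exact/gx/h.
by apply: negligibleS (negligible_set0 _) => x [].
Qed.

End vanishing.

End du_bois_reymond.

(** * Weak derivatives of singular functions *)

Section weak_calculus.
Context {R : realType} {m : nat}.
Implicit Types (x : 'rV[R]_m) (f g h phi : 'rV[R]_m -> R) (k l : 'I_m).
Local Notation mu := (@lebesgue_rV R m).
Local Notation B := (@unit_ball R m).

(** Exhaustion of the open ball by the closed balls of radius 1 - 1/(n+1), which are compact. *)
Lemma loc_integrable_measurable f : loc_integrable f -> measurable_fun B f.
Proof.
move=> lf; pose K (n : nat) := [set x : 'rV[R]_m | euclid x <= 1 - n.+1%:R^-1].
have cK n : closed (K n).
  rewrite (_ : K n = (@euclid R m) @^-1` [set y | y <= 1 - n.+1%:R^-1])//.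
  by apply: closed_comp; [move=> x _; exact: continuous_euclid|exact: closed_le].
have KB n : K n `<=` B.
  by move=> x /le_lt_trans; apply; rewrite ltrBlDr ltrDl invr_gt0.
have kK n : compact (K n).
  apply: (subclosed_compact (cK n) (@compact_cbox R m (fun=> -1) (fun=> 1))).
  exact: subset_trans (KB n) (@unit_ball_sub_cbox R m).
rewrite (_ : B = \bigcup_n K n).
  apply/measurable_fun_bigcup => n; first exact: measurable_compact.
  by apply/measurable_EFinP; apply: measurable_int (lf _ (kK n) (KB n)).
apply/seteqP; split => [x Bx|x [n _ /KB]//].
have r0 : 0 < 1 - euclid x by rewrite subr_gt0.
have [n _ /(_ n (leqnn n))/= nx] := near_infty_natSinv_lt (PosNum r0).
by exists n => //; rewrite /K/=; move: nx; set d := _^-1; lra.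
Qed.

Lemma loc_integrableB f g : loc_integrable f -> loc_integrable g ->
  loc_integrable (fun x => f x - g x).
Proof.
move=> lf lg K cK KB; have mK := measurable_compact cK.
exact: (integrableB mK (lf _ cK KB) (lg _ cK KB)).
Qed.

Lemma ae_eq_Rintegral f g : measurable_fun B f -> measurable_fun B g ->
  {ae mu, forall x, B x -> f x = g x} ->
  \int[mu]_(x in B) f x = \int[mu]_(x in B) g x.
Proof.
move=> mf mg fg; rewrite /Rintegral; congr fine.
apply: ae_eq_integral; [exact: measurable_unit_ball|exact/measurable_EFinP|exact/measurable_EFinP|].
by apply: filterS fg => x h Bx; rewrite h.
Qed.

Lemma test_measurable phi : test_function phi -> measurable_fun B phi.
Proof.
move=> tphi; apply: measurable_funTS; apply: measurable_fun_rV_continuous.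
exact/smooth_continuous/test_function_smooth.
Qed.

Lemma is_weak_partial_unique k f g h :
  is_weak_partial k f g -> is_weak_partial k f h ->
  {ae mu, forall x, B x -> g x = h x}.
Proof.
move=> [lf lg fg] [_ lh fh].
have := @ae_eq0_unit_ball R m _ (loc_integrableB lg lh).
move=> H; have {}H : {ae mu, forall x, B x -> g x - h x = 0}.
  apply: H => phi tphi.
  have mB := @measurable_unit_ball R m.
  under eq_Rintegral do rewrite mulrBl.
  rewrite RintegralB//; [|exact: integrable_loc_test..].
  by apply/eqP; rewrite subr_eq0 -eqr_opp -fg// fh.
by apply: filterS H => x H /H /eqP; rewrite subr_eq0 => /eqP.
Qed.

(** Needed for second derivatives: the function differentiated again is a chosen weak derivative,
    known only almost everywhere. *)
Lemma ae_is_weak_partial k f h g : loc_integrable f -> loc_integrable h ->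
  {ae mu, forall x, B x -> f x = h x} ->
  is_weak_partial k h g -> is_weak_partial k f g.
Proof.
move=> lf lh fh [_ lg hg]; split => // phi tphi; rewrite -hg//.
have mdphi := test_measurable (test_function_partial k tphi).
apply: ae_eq_Rintegral.
- by apply: measurable_funM => //; exact: loc_integrable_measurable.
- by apply: measurable_funM => //; exact: loc_integrable_measurable.
- by apply: filterS fh => x H Bx; rewrite H.
Qed.

Lemma wpartialP k f g : is_weak_partial k f g ->
  is_weak_partial k f (wpartial k f) /\
  {ae mu, forall x, B x -> wpartial k f x = g x}.
Proof.
move=> fg; have H : is_weak_partial k f (wpartial k f).
  by apply: (xgetPex (fun=> 0) (P := [set g | is_weak_partial k f g])); exists g.
by split => //; exact: is_weak_partial_unique H fg.
Qed.

Hypothesis m5 : (4 < m)%N.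

Lemma sing_loc_integrable n f : (n <= 4)%N -> sing n f -> loc_integrable f.
Proof.
move=> n4 sf K cK KB; apply: integrableS (sing_integrable m5 n4 sf) => //.
- exact: measurable_unit_ball.
- exact: measurable_compact.
Qed.

Lemma sing_is_weak_partial n k f : (n <= 3)%N -> sing n f ->
  is_weak_partial k f (partial k f).
Proof.
move=> n3 sf; split.
- exact: (sing_loc_integrable (leqW n3) sf).
- by apply: (sing_loc_integrable _ (sing_partial k sf)).
- by move=> phi tphi; exact: (sing_by_parts m5 k n3 sf tphi).
Qed.

Lemma sing_wpartial n k f : (n <= 3)%N -> sing n f ->
  is_weak_partial k f (wpartial k f) /\
  {ae mu, forall x, B x -> wpartial k f x = partial k f x}.
Proof. by move=> n3 sf; apply: wpartialP; exact: sing_is_weak_partial sf. Qed.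

Lemma sing_wpartial2 n k l f : (n <= 2)%N -> sing n f ->
  is_weak_partial k (wpartial l f) (wpartial k (wpartial l f)) /\
  {ae mu, forall x, B x -> wpartial k (wpartial l f) x = partial k (partial l f) x}.
Proof.
move=> n2 sf; have [[_ lw _] fw] := sing_wpartial l (leqW n2) sf.
have sdf := sing_partial l sf; have n3 : (n.+1 <= 3)%N by [].
apply: wpartialP; apply: ae_is_weak_partial fw _ => //.
- by apply: (sing_loc_integrable _ sdf); exact: leqW.
- exact: (sing_is_weak_partial k n3 sdf).
Qed.

(** Measurability of both sides is bundled with equality almost everywhere, so that the relation
    respects arithmetic and transfers integrals. *)
Definition represents g f :=
  [/\ measurable_fun B g, measurable_fun B f & {ae mu, forall x, B x -> g x = f x}].

Lemma represents_refl f : measurable_fun B f -> represents f f.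
Proof. by move=> mf; split => //; exact: aeW. Qed.

Lemma representsD g1 f1 g2 f2 : represents g1 f1 -> represents g2 f2 ->
  represents (fun x => g1 x + g2 x) (fun x => f1 x + f2 x).
Proof.
move=> [mg1 mf1 e1] [mg2 mf2 e2]; split; [exact: measurable_funD..|].
by apply: filterS2 e1 e2 => x H1 H2 Bx; rewrite H1// H2.
Qed.

Lemma representsB g1 f1 g2 f2 : represents g1 f1 -> represents g2 f2 ->
  represents (fun x => g1 x - g2 x) (fun x => f1 x - f2 x).
Proof.
move=> [mg1 mf1 e1] [mg2 mf2 e2]; split; [exact: measurable_funB..|].
by apply: filterS2 e1 e2 => x H1 H2 Bx; rewrite H1// H2.
Qed.

Lemma representsM g1 f1 g2 f2 : represents g1 f1 -> represents g2 f2 ->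
  represents (fun x => g1 x * g2 x) (fun x => f1 x * f2 x).
Proof.
move=> [mg1 mf1 e1] [mg2 mf2 e2]; split; [exact: measurable_funM..|].
by apply: filterS2 e1 e2 => x H1 H2 Bx; rewrite H1// H2.
Qed.

Lemma representsX n g f : represents g f ->
  represents (fun x => g x ^+ n) (fun x => f x ^+ n).
Proof.
case=> mg mf gf; split; [exact: measurable_funX..|].
by apply: filterS gf => x H Bx; rewrite H.
Qed.

Lemma represents_sum (I : finType) (G F : I -> 'rV[R]_m -> R) :
  (forall i, represents (G i) (F i)) ->
  represents (fun x => \sum_i G i x) (fun x => \sum_i F i x).
Proof.
move=> GF; elim: (index_enum I) => [|i r IHr].
  rewrite (_ : (fun x => \sum_(i <- [::]) G i x) = fun=> 0).
    rewrite (_ : (fun x => \sum_(i <- [::]) F i x) = fun=> 0).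
      by apply: represents_refl; exact: measurable_cst.
    by apply/funext => x; rewrite big_nil.
  by apply/funext => x; rewrite big_nil.
rewrite (_ : (fun x => \sum_(j <- i :: r) G j x) = fun x => G i x + \sum_(j <- r) G j x).
  rewrite (_ : (fun x => \sum_(j <- i :: r) F j x) = fun x => F i x + \sum_(j <- r) F j x).
    exact: representsD.
  by apply/funext => x; rewrite big_cons.
by apply/funext => x; rewrite big_cons.
Qed.

Lemma represents_off0 g f1 f2 : represents g f1 -> measurable_fun B f2 ->
  (forall x, B x -> x != 0 -> f1 x = f2 x) -> represents g f2.
Proof.
move=> [mg mf1 e1] mf2 e2; split => //.
have e0 : {ae mu, forall x, x != 0}.
  exists [set 0]; split; [exact: measurable_set0|exact: lebesgue_origin|].
  by move=> x /= /negP; rewrite negbK => /eqP.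
by apply: filterS2 e1 e0 => x H1 x0 Bx; rewrite H1// e2.
Qed.

Lemma represents_Rintegral g f : represents g f ->
  \int[mu]_(x in B) g x = \int[mu]_(x in B) f x.
Proof. by case=> *; exact: ae_eq_Rintegral. Qed.

Lemma sing_measurable_ball n f : sing n f -> measurable_fun B f.
Proof. by move=> sf; apply: measurable_funTS; exact: sing_measurable sf. Qed.

Lemma represents_wpartial n k f : (n <= 3)%N -> sing n f ->
  represents (wpartial k f) (partial k f).
Proof.
move=> n3 sf; have [[_ lw _] fw] := sing_wpartial k n3 sf; split => //.
- exact: loc_integrable_measurable.
- exact: sing_measurable_ball (sing_partial k sf).
Qed.

Lemma represents_wpartial2 n k l f : (n <= 2)%N -> sing n f ->
  represents (wpartial k (wpartial l f)) (partial k (partial l f)).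
Proof.
move=> n3 sf; have [[_ lw _] fw] := sing_wpartial2 k l n3 sf; split => //.
- exact: loc_integrable_measurable.
- exact: sing_measurable_ball (sing_partial k (sing_partial l sf)).
Qed.

Lemma represents_wlaplacian n f : (n <= 2)%N -> sing n f ->
  represents (wlaplacian f) (laplacian f).
Proof.
by move=> n2 sf; apply: represents_sum => k; exact: represents_wpartial2 sf.
Qed.

(** The square of f is O(r^-2n), integrable because 2 n <= 4. *)
Lemma represents_L2 n g f : (n <= 2)%N -> sing n f -> represents g f -> L2 g.
Proof.
move=> n2 sf [mg mf gf]; split => //.
have sff : sing (n + n) (fun x => f x * f x) by exact: singM.
have n4 : (n + n <= 4)%N by rewrite (leq_add n2 n2).
have /integrableP[mff fin] := sing_integrable m5 n4 sff.
have mgg : measurable_fun B (fun x => (g x ^+ 2)%:E).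
  by apply/measurable_EFinP; exact: measurable_funX.
apply/integrableP; split => //; apply: le_lt_trans fin.
rewrite le_eqVlt; apply/orP; left; apply/eqP; apply: ae_eq_integral => //.
- exact: measurable_unit_ball.
- exact: measurableT_comp.
- exact: measurableT_comp.
- by apply: filterS gf => x H Bx; rewrite /= H.
Qed.

Lemma sing_L2 n f : (n <= 2)%N -> sing n f -> L2 f.
Proof.
move=> n2 sf; apply: (represents_L2 n2 sf); apply: represents_refl.
exact: sing_measurable_ball sf.
Qed.

Lemma sing_W12 n f : (n <= 1)%N -> sing n f -> W12 f.
Proof.
move=> n1 sf; split; first exact: sing_L2 (leqW n1) sf.
move=> k; have n3 := leqW (leqW n1).
split; first by have [] := sing_wpartial k n3 sf.
by apply: (represents_L2 _ (sing_partial k sf)) => //; exact: represents_wpartial sf.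
Qed.

Lemma sing_W22 f : sing 0 f -> W22 f.
Proof.
move=> sf; split; first exact: sing_W12 sf.
move=> k; split.
  by apply: (represents_L2 _ (sing_partial k sf)) => //; exact: represents_wpartial sf.
move=> l; split; first by have [] := sing_wpartial2 l k (leq0n 2) sf.
apply: (represents_L2 (leqnn 2) (sing_partial l (sing_partial k sf))).
exact: represents_wpartial2 sf.
Qed.

End weak_calculus.

(** * The eigenmap v *)

Section laplacian_rules.
Context {R : realType} {m : nat}.
Implicit Types (x : 'rV[R]_m) (f g : 'rV[R]_m -> R) (i j k : 'I_m).

Definition grad_dot f g x := \sum_k partial k f x * partial k g x.

Lemma eq_laplacian_off0 f g x : (forall y, y != 0 -> f y = g y) -> x != 0 ->
  laplacian f x = laplacian g x.
Proof.
move=> fg x0; apply: eq_bigr => k _; apply: eq_partial_off0 => // y y0.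
exact: eq_partial_off0.
Qed.

Lemma laplacian_cst (c : R) x : laplacian (fun=> c) x = 0.
Proof.
rewrite /laplacian big1// => k _; rewrite (_ : partial k (fun=> c) = fun=> 0) ?partial_cst//.
by apply/funext => y; rewrite partial_cst.
Qed.

Lemma laplacianD n p f g x : sing n f -> sing p g -> x != 0 ->
  laplacian (fun x => f x + g x) x = laplacian f x + laplacian g x.
Proof.
move=> sf sg x0; rewrite -big_split/=; apply: eq_bigr => k _.
rewrite (@eq_partial_off0 _ _ _ _ (fun x => partial k f x + partial k g x))//.
  by rewrite partialD//; [exact: sing_pderivable (sing_partial k sf) _|exact: sing_pderivable
    (sing_partial k sg) _].
by move=> y y0; rewrite partialD//; [exact: sing_pderivable sf _|exact: sing_pderivable sg _].
Qed.

Lemma laplacianM n p f g x : sing n f -> sing p g -> x != 0 ->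
  laplacian (fun x => f x * g x) x =
  laplacian f x * g x + 2 * grad_dot f g x + f x * laplacian g x.
Proof.
move=> sf sg x0.
have df y : y != 0 -> pderivable f y by exact: sing_pderivable sf.
have dg y : y != 0 -> pderivable g y by exact: sing_pderivable sg.
rewrite /laplacian /grad_dot mulr_suml !mulr_sumr -!big_split/=; apply: eq_bigr => k _.
have ddf := sing_pderivable (sing_partial k sf) x0.
have ddg := sing_pderivable (sing_partial k sg) x0.
rewrite (@eq_partial_off0 _ _ _ _ (fun x => partial k f x * g x + f x * partial k g x))//.
  rewrite (partialD _ (pderivableM ddf (dg _ x0)) (pderivableM (df _ x0) ddg)).
  rewrite (partialM _ ddf (dg _ x0)) (partialM _ (df _ x0) ddg).
  by rewrite mulr2n mulrDl mul1r !addrA.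
by move=> y y0; rewrite (partialM _ (df _ y0) (dg _ y0)).
Qed.

Lemma laplacianZ n (c : R) f x : sing n f -> x != 0 ->
  laplacian (fun x => c * f x) x = c * laplacian f x.
Proof.
move=> sf x0; rewrite (laplacianM (sing_cst c) sf x0) laplacian_cst mul0r add0r.
by rewrite /grad_dot big1 ?mulr0 ?add0r// => k _; rewrite partial_cst mul0r.
Qed.

Lemma laplacian_sum (I : eqType) (r : seq I) n (F : I -> 'rV[R]_m -> R) x :
  (forall a, sing n (F a)) -> x != 0 ->
  laplacian (fun x => \sum_(i <- r) F i x) x = \sum_(i <- r) laplacian (F i) x.
Proof.
move=> sF x0; elim: r => [|i r IHr].
  by under eq_fun do rewrite big_nil; rewrite big_nil laplacian_cst.
under eq_fun do rewrite big_cons.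
by rewrite big_cons -IHr (laplacianD (sF i) (sing_sum r sF) x0).
Qed.

Lemma grad_dotC f g x : grad_dot f g x = grad_dot g f x.
Proof. by apply: eq_bigr => k _; rewrite mulrC. Qed.

Lemma grad_dotDl f1 f2 g x : pderivable f1 x -> pderivable f2 x ->
  grad_dot (fun x => f1 x + f2 x) g x = grad_dot f1 g x + grad_dot f2 g x.
Proof.
move=> d1 d2; rewrite -big_split/=; apply: eq_bigr => k _.
by rewrite (partialD _ d1 d2) mulrDl.
Qed.

Lemma grad_dotMl f1 f2 g x : pderivable f1 x -> pderivable f2 x ->
  grad_dot (fun x => f1 x * f2 x) g x = grad_dot f1 g x * f2 x + f1 x * grad_dot f2 g x.
Proof.
move=> d1 d2; rewrite mulr_suml mulr_sumr -big_split/=; apply: eq_bigr => k _.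
by rewrite (partialM _ d1 d2); ring.
Qed.

Lemma grad_dot_cstl (c : R) g x : grad_dot (fun=> c) g x = 0.
Proof. by rewrite /grad_dot big1// => k _; rewrite partial_cst mul0r. Qed.

End laplacian_rules.

(** * Gradients and Laplacians of x_i/|x| and of powers of 1/|x| *)

Section homogeneous_maps.
Context {R : realType} {m : nat}.
Implicit Types (x : 'rV[R]_m) (f g : 'rV[R]_m -> R) (i j k : 'I_m).
Local Notation M := (m%:R : R).

Lemma sum_delta i (F : 'I_m -> R) : \sum_k (i == k)%:R * F k = F i.
Proof.
rewrite (bigD1 i)//= eqxx mul1r big1 ?addr0// => k; rewrite eq_sym => /negPf ->.
by rewrite mul0r.
Qed.

(** Common normal form for the index sums below: a constant, a multiple of omega_k^2 and two
    Kronecker terms. Each sum is brought to it by [ring], with zero padding where a slot is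
    empty. *)
Lemma sum_omega_form x (a b : R) i j (F G : 'I_m -> R) : x != 0 ->
  \sum_k (a + b * omega k x ^+ 2 + (i == k)%:R * F k + (j == k)%:R * G k) =
  M * a + b + F i + G j.
Proof.
move=> x0; rewrite !big_split/= !sum_delta -mulr_sumr sum_omega_sqr// mulr1.
by rewrite sumr_const card_ord mulr_natl.
Qed.

Lemma grad_dot_omega i j x : x != 0 ->
  grad_dot (omega i) (omega j) x =
  rinv x ^+ 2 * ((i == j)%:R - omega i x * omega j x).
Proof.
move=> x0; rewrite /grad_dot.
pose u := omega i x; pose w := omega j x; pose q := rinv x ^+ 2.
rewrite (eq_bigr (fun k => 0 + (q * u * w) * omega k x ^+ 2 +
    (i == k)%:R * (q * ((j == k)%:R - w * omega k x)) +
    (j == k)%:R * (- (q * u * omega k x)))); last first.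
  by move=> k _; rewrite !partial_omega// /q /u /w; ring.
by rewrite sum_omega_form// /q /u /w [j == i]eq_sym; ring.
Qed.

(** Spherical harmonics of degree one have eigenvalue m - 1. *)
Lemma laplacian_omega i x : x != 0 ->
  laplacian (omega i) x = - ((M - 1) * rinv x ^+ 2 * omega i x).
Proof.
move=> x0; rewrite /laplacian.
pose u := omega i x; pose q := rinv x ^+ 2.
rewrite (eq_bigr (fun k => - (q * u) + (3 * q * u) * omega k x ^+ 2 +
    (i == k)%:R * (- (2 * q * omega k x)) +
    (i == k)%:R * 0)); last first.
  move=> k _.
  rewrite (@eq_partial_off0 _ _ _ _ (fun x => rinv x * ((i == k)%:R + (-1) *
    (omega i x * omega k x))))//; last first.
    by move=> y y0; rewrite partial_omega// mulN1r.
  have dr := pderivable_rinv x0.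
  have di := pderivable_omega i x0; have dk := pderivable_omega k x0.
  have dik := pderivableM di dk.
  have dz := pderivableM (pderivable_cst (-1) x) dik.
  rewrite (partialM _ dr (pderivableD (pderivable_cst _ x) dz)).
  rewrite (partialD _ (pderivable_cst _ x) dz) partial_cst (partialZ _ _ dik).
  rewrite (partialM _ di dk) partial_rinv// !partial_omega// eqxx /q /u /=.
  by case: (i == k) => /=; ring.
by rewrite sum_omega_form// /q /u; ring.
Qed.

Lemma grad_dot_rinv_omega i x : x != 0 -> grad_dot (@rinv R m) (omega i) x = 0.
Proof.
move=> x0; rewrite /grad_dot; pose q := rinv x ^+ 3; pose u := omega i x.
rewrite (eq_bigr (fun k => 0 + (q * u) * omega k x ^+ 2 +
    (i == k)%:R * (- (q * omega k x)) + (i == k)%:R * 0)); last first.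
  by move=> k _; rewrite partial_rinv// partial_omega// /q /u; ring.
by rewrite sum_omega_form// /q /u; ring.
Qed.

Lemma grad_dot_rinv x : x != 0 -> grad_dot (@rinv R m) (@rinv R m) x = rinv x ^+ 4.
Proof.
move=> x0; rewrite /grad_dot.
rewrite (eq_bigr (fun k => rinv x ^+ 4 * omega k x ^+ 2)); last first.
  by move=> k _; rewrite partial_rinv//; ring.
by rewrite -mulr_sumr sum_omega_sqr// mulr1.
Qed.

(** The case p = -1 of Delta r^p = p (p + m - 2) r^(p-2). *)
Lemma laplacian_rinv x : x != 0 -> laplacian (@rinv R m) x = - ((M - 3) * rinv x ^+ 3).
Proof.
move=> x0; rewrite /laplacian; pose q := rinv x ^+ 3.
rewrite (eq_bigr (fun k => - q + (3 * q) * omega k x ^+ 2)); last first.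
  move=> k _.
  rewrite (@eq_partial_off0 _ _ _ _ (fun x => (-1) * (omega k x * (rinv x * rinv x))))//;
    last first.
    by move=> y y0; rewrite partial_rinv// mulN1r expr2.
  have dr := pderivable_rinv x0; have dk := pderivable_omega k x0.
  have drr := pderivableM dr dr.
  rewrite (partialZ _ _ (pderivableM dk drr)) (partialM _ dk drr) (partialM _ dr dr).
  by rewrite partial_rinv// partial_omega// eqxx /q /=; ring.
rewrite big_split/= -mulr_sumr sum_omega_sqr// sumr_const card_ord -mulr_natl /q.
by ring.
Qed.

Let sr := @sing_rinv R m.
Let srr : sing 2 (fun x => rinv x * rinv x) := singM sr sr.

Lemma laplacian_rinv2 x : x != 0 ->
  laplacian (fun x => rinv x * rinv x) x = - (2 * (M - 4) * rinv x ^+ 4).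
Proof.
by move=> x0; rewrite (laplacianM sr sr x0) laplacian_rinv// grad_dot_rinv//; ring.
Qed.

(* The hypothesis on [grad_dot rinv f] is the vanishing of the radial derivative of f. *)
Lemma laplacian_rinv2M lam f x : sing 0 f -> grad_dot (@rinv R m) f x = 0 ->
  laplacian f x = - (lam * rinv x ^+ 2 * f x) -> x != 0 ->
  laplacian (fun x => rinv x * rinv x * f x) x =
  - ((lam + 2 * (M - 4)) * rinv x ^+ 4 * f x).
Proof.
move=> sf rf lf x0; rewrite (laplacianM srr sf x0) laplacian_rinv2// lf.
have dr := pderivable_rinv x0.
by rewrite (grad_dotMl _ dr dr) rf; ring.
Qed.

End homogeneous_maps.

(** * The components of v as cubic spherical harmonics *)

Section eigenmap.
Context {R : realType} {m : nat}.
Implicit Types (x : 'rV[R]_m) (i j k : 'I_m).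
Local Notation M := (m%:R : R).
Local Notation idx := ('I_m * 'I_m * 'I_m)%type.
Hypothesis m5 : (4 < m)%N.

Let kappa : R := (Num.sqrt ((M - 1) * (M + 2)))^-1.

(** Divided by m + 2, this is the correction that makes the cubic monomial trace-free, hence
    harmonic as a cubic form. *)
Definition trace_part i j k x : R :=
  (i == j)%:R * omega k x + (j == k)%:R * omega i x + (i == k)%:R * omega j x.

Definition cubic_part i j k x : R := omega i x * omega j x * omega k x.

Lemma vmapE i j k x : vmap (i, j, k) x =
  kappa * (trace_part i j k x + (- (M + 2)) * cubic_part i j k x).
Proof.
rewrite /vmap /trace_part /cubic_part /omega /rinv -exprVn -/kappa.
by congr (_ * _); ring.
Qed.

Lemma sing_trace_part i j k : sing 0 (trace_part i j k).
Proof. by apply: singD; [apply: singD|]; apply: singZ; exact: sing_omega. Qed.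

Lemma sing_cubic_part i j k : sing 0 (cubic_part i j k).
Proof.
exact: (singM (singM (sing_omega i) (sing_omega j)) (sing_omega k)).
Qed.

Lemma sing_vmap (b : idx) : sing 0 (@vmap R m b).
Proof.
case: b => [[i j] k].
apply: (sing_ext (f := fun x => kappa * (trace_part i j k x + (- (M + 2)) * cubic_part i j k x))).
  apply: singZ; apply: singD; first exact: sing_trace_part.
  by apply: singZ; exact: sing_cubic_part.
by move=> x _; rewrite vmapE.
Qed.

Lemma laplacian_trace_part i j k x : x != 0 ->
  laplacian (trace_part i j k) x = - ((M - 1) * rinv x ^+ 2 * trace_part i j k x).
Proof.
move=> x0; have s c l : sing 0 (fun x => c * omega l x) := singZ c (sing_omega l).
rewrite (laplacianD (singD (s _ _) (s _ _)) (s _ _) x0) (laplacianD (s _ _) (s _ _) x0).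
by rewrite !(laplacianZ _ (sing_omega _) x0) !laplacian_omega// /trace_part; ring.
Qed.

Lemma laplacian_cubic_part i j k x : x != 0 ->
  laplacian (cubic_part i j k) x =
  rinv x ^+ 2 * (2 * trace_part i j k x - 3 * (M + 1) * cubic_part i j k x).
Proof.
move=> x0; have s l := @sing_omega R m l; have d l := pderivable_omega l x0.
rewrite (laplacianM (singM (s i) (s j)) (s k) x0) (laplacianM (s i) (s j) x0).
rewrite (grad_dotMl _ (d i) (d j)) !grad_dot_omega// !laplacian_omega//.
by rewrite /trace_part /cubic_part; ring.
Qed.

(** The coefficient m + 2 cancels the mixed terms: the trace part receives -(m - 1) - 2 (m + 2) = -3
    (m + 1), the factor already found on the cubic part. This is the degree-three eigenvalue 3 (3 +
    m - 2). *)
Lemma laplacian_vmap (b : idx) x : x != 0 ->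
  laplacian (vmap b) x = - (3 * (M + 1) * rinv x ^+ 2 * vmap b x).
Proof.
case: b => [[i j] k] x0.
have sc := singZ (- (M + 2)) (sing_cubic_part i j k).
rewrite (@eq_laplacian_off0 _ _ _ _ _ (fun y _ => vmapE i j k y) x0).
rewrite (laplacianZ _ (singD (sing_trace_part i j k) sc) x0).
rewrite (laplacianD (sing_trace_part i j k) sc x0) (laplacianZ _ (sing_cubic_part i j k) x0).
by rewrite laplacian_trace_part// laplacian_cubic_part// vmapE; ring.
Qed.

Lemma grad_dot_rinv_vmap (b : idx) x : x != 0 -> grad_dot (@rinv R m) (vmap b) x = 0.
Proof.
case: b => [[i j] k] x0; rewrite grad_dotC.
have d l := pderivable_omega l x0.
have r0 l : grad_dot (omega l) (@rinv R m) x = 0 by rewrite grad_dotC grad_dot_rinv_omega.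
have dc c : pderivable (fun=> c) x by exact: pderivable_cst.
have -> : vmap (i, j, k) = fun x =>
    kappa * (trace_part i j k x + (- (M + 2)) * cubic_part i j k x).
  by apply/funext => y; rewrite vmapE.
have dcub := pderivableM (pderivableM (d i) (d j)) (d k).
have dt1 := pderivableM (dc (i == j)%:R) (d k).
have dt2 := pderivableM (dc (j == k)%:R) (d i).
have dt3 := pderivableM (dc (i == k)%:R) (d j).
have dt := pderivableD (pderivableD dt1 dt2) dt3.
have dz := pderivableM (dc (- (M + 2))) dcub.
rewrite (grad_dotMl _ (dc kappa) (pderivableD dt dz)) (grad_dotDl _ dt dz).
rewrite (grad_dotMl _ (dc (- (M + 2))) dcub) (grad_dotMl _ (pderivableM (d i) (d j)) (d k)).
rewrite (grad_dotMl _ (d i) (d j)) (grad_dotDl _ (pderivableD dt1 dt2) dt3) (grad_dotDl _ dt1 dt2).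
rewrite (grad_dotMl _ (dc (i == j)%:R) (d k)) (grad_dotMl _ (dc (j == k)%:R) (d i)).
rewrite (grad_dotMl _ (dc (i == k)%:R) (d j)) !grad_dot_cstl !r0.
by ring.
Qed.

(** Contracting over k, j and i in turn leaves kappa^2 (3 m + 6 - 6 c + c^2) with c = m + 2, and the
    bracket equals (m - 1)(m + 2). *)
Lemma sum_vmap_sqr x : x != 0 -> \sum_(b : idx) vmap b x ^+ 2 = 1.
Proof.
move=> x0.
have -> : \sum_(b : idx) vmap b x ^+ 2 = \sum_i \sum_j \sum_k vmap (i, j, k) x ^+ 2.
  by rewrite pair_bigA pair_bigA; apply: eq_bigr => -[[i j] k].
pose c := M + 2.
have Sk i j : \sum_k vmap (i, j, k) x ^+ 2 = kappa ^+ 2 *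
    (((i == j)%:R - c * (omega i x * omega j x)) ^+ 2 + omega i x ^+ 2 + omega j x ^+ 2 +
     4 * ((i == j)%:R - c * (omega i x * omega j x)) * (omega i x * omega j x) +
     2 * (omega i x * omega j x) * (i == j)%:R).
  pose a := (i == j)%:R - c * (omega i x * omega j x).
  pose u := omega i x; pose w := omega j x.
  rewrite (eq_bigr (fun k => kappa ^+ 2 * (0 + a ^+ 2 * omega k x ^+ 2 +
     (i == k)%:R * (w ^+ 2 + 2 * a * w * omega k x) +
     (j == k)%:R * (u ^+ 2 + 2 * a * u * omega k x + 2 * u * w * (i == k)%:R)))); last first.
    move=> k _; rewrite vmapE /trace_part /cubic_part -/c /a /u /w.
    by case: (i == k); case: (j == k) => /=; ring.
  by rewrite -mulr_sumr sum_omega_form// /a /u /w; ring.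
have Sj i : \sum_j \sum_k vmap (i, j, k) x ^+ 2 = kappa ^+ 2 *
   (2 + (M + 6 - 6 * c + c ^+ 2) * omega i x ^+ 2).
  under eq_bigr do rewrite Sk; rewrite -mulr_sumr; congr (_ * _).
  pose u := omega i x.
  rewrite (eq_bigr (fun j => u ^+ 2 + (1 + (c ^+ 2 - 4 * c) * u ^+ 2) * omega j x ^+ 2 +
     (i == j)%:R * (1 + (6 - 2 * c) * u * omega j x) + (i == j)%:R * 0)); last first.
    by move=> j _; rewrite /u; case: (i == j) => /=; ring.
  by rewrite sum_omega_form// /u; ring.
under eq_bigr do rewrite Sj; rewrite -mulr_sumr big_split/= -mulr_sumr sum_omega_sqr//.
rewrite sumr_const card_ord -mulr_natl.
have M5 : 4 < M by rewrite ltr_nat.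
have kE : kappa ^+ 2 = ((M - 1) * (M + 2))^-1.
  by rewrite /kappa exprVn sqr_sqrtr// mulr_ge0//; lra.
rewrite kE /c; apply: (@mulfI _ ((M - 1) * (M + 2))).
  by apply: mulf_neq0; apply/eqP; lra.
by rewrite mulrA mulfV ?mul1r; [ring|apply: mulf_neq0; apply/eqP; lra].
Qed.

Let svv (b : idx) : sing 0 (fun x => vmap b x * vmap b x) := singM (sing_vmap b) (sing_vmap b).

Let sum_off0 y : y != 0 -> \sum_(b : idx) vmap b y * vmap b y = (1 : R).
Proof. by move=> y0; rewrite -(sum_vmap_sqr y0); apply: eq_bigr => b _; rewrite expr2. Qed.

(** First derivative of the constraint |v|^2 = 1. *)
Lemma sum_vmap_partial k x : x != 0 -> \sum_(b : idx) vmap b x * partial k (vmap b) x = 0.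
Proof.
move=> x0; have d b := sing_pderivable (sing_vmap b) x0.
have := @eq_partial_off0 _ _ k _ _ x sum_off0 x0.
rewrite partial_cst partial_sum; last by move=> b; exact: pderivableM.
rewrite (eq_bigr (fun b => 2 * (vmap b x * partial k (vmap b) x))); last first.
  by move=> b _; rewrite (partialM _ (d b) (d b)); ring.
by rewrite -mulr_sumr => /eqP; rewrite mulf_eq0 pnatr_eq0/= => /eqP.
Qed.

(** Laplacian of the constraint: 0 = 2 |grad v|^2 + 2 <v, Delta v>, with Delta v known. *)
Lemma sum_grad_vmap x : x != 0 ->
  \sum_(b : idx) grad_dot (vmap b) (vmap b) x = 3 * (M + 1) * rinv x ^+ 2.
Proof.
move=> x0; have := @eq_laplacian_off0 _ _ _ _ x sum_off0 x0.
rewrite laplacian_cst (laplacian_sum _ svv x0).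
rewrite (eq_bigr (fun b => 2 * grad_dot (vmap b) (vmap b) x +
   (- (2 * (3 * (M + 1) * rinv x ^+ 2))) * vmap b x ^+ 2)); last first.
  by move=> b _; rewrite (laplacianM (sing_vmap b) (sing_vmap b) x0) laplacian_vmap//; ring.
by rewrite big_split/= -!mulr_sumr sum_vmap_sqr// mulr1; lra.
Qed.

End eigenmap.

(** * The weak biharmonic equation *)

Section biharmonicity.
Context {R : realType} {m : nat}.
Implicit Types (x : 'rV[R]_m) (i j k : 'I_m).
Local Notation mu := (@lebesgue_rV R m).
Local Notation B := (@unit_ball R m).
Local Notation M := (m%:R : R).
Local Notation idx := ('I_m * 'I_m * 'I_m)%type.
Hypothesis m5 : (4 < m)%N.

(** Integrability accompanies the vanishing integral so that sums of null functions are again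
    null. *)
Definition null (f : 'rV[R]_m -> R) :=
  mu.-integrable B (EFin \o f) /\ \int[mu]_(x in B) f x = 0.

Lemma nullD f g : null f -> null g -> null (fun x => f x + g x).
Proof.
have mB := @measurable_unit_ball R m.
move=> [if_ f0] [ig g0]; split; first exact: (integrableD mB if_ ig).
by rewrite RintegralD// f0 g0 addr0.
Qed.

Lemma nullZ (c : R) f : null f -> null (fun x => c * f x).
Proof.
have mB := @measurable_unit_ball R m.
move=> [if_ f0]; split; first exact: (integrableZl mB c if_).
by rewrite RintegralZl// f0 mulr0.
Qed.

Lemma null_sum (I : eqType) (r : seq I) (F : I -> 'rV[R]_m -> R) :
  (forall a, null (F a)) -> null (fun x => \sum_(a <- r) F a x).
Proof.
move=> F0; elim: r => [|a r IHr].
  under eq_fun do rewrite big_nil.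
  split; last by rewrite /Rintegral integral0.
  exact: (sing_integrable m5 (leq0n 4) (sing_cst 0)).
by under eq_fun do rewrite big_cons; exact: nullD.
Qed.

Lemma Rintegral_null f g : mu.-integrable B (EFin \o f) -> null g ->
  \int[mu]_(x in B) (f x + g x) = \int[mu]_(x in B) f x.
Proof.
have mB := @measurable_unit_ball R m.
by move=> if_ [ig g0]; rewrite RintegralD// g0 addr0.
Qed.

Lemma sing_laplacian_test phi : test_function phi -> sing 0 (@laplacian R m phi).
Proof.
by move=> tphi; apply: sing_sum => k; apply: sing_test; do 2!apply: test_function_partial.
Qed.

(** Green's second identity across the origin, by two integrations by parts: the first with f =
    O(r^-2), the second with its derivative, O(r^-3), the strongest singularity allowed. *)
Lemma null_green f phi : sing 2 f -> test_function phi ->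
  null (fun x => f x * laplacian phi x - laplacian f x * phi x).
Proof.
move=> sf tphi.
rewrite (_ : (fun x => _) = fun x => \sum_k (f x * partial k (partial k phi) x -
    partial k (partial k f) x * phi x)); last first.
  by apply/funext => x; rewrite big_split/= sumrN -mulr_sumr -mulr_suml.
apply: null_sum => k.
have tp := test_function_partial k tphi; have tpp := test_function_partial k tp.
have sp := sing_partial k sf.
have i1 : mu.-integrable B (EFin \o (fun x => f x * partial k (partial k phi) x)).
  exact: (sing_integrable m5 (isT : (2 + 0 <= 4)%N) (singM sf (sing_test tpp))).
have i2 : mu.-integrable B (EFin \o (fun x => partial k (partial k f) x * phi x)).
  exact: (sing_integrable m5 (isT : (4 + 0 <= 4)%N) (singM (sing_partial k sp) (sing_test tphi))).
have mB := @measurable_unit_ball R m.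
split; first exact: (integrableB mB i1 i2).
rewrite RintegralB//.
rewrite (sing_by_parts m5 k (isT : (2 <= 3)%N) sf tp).
by rewrite (sing_by_parts m5 k (leqnn 3) sp tphi) opprK subrr.
Qed.

Lemma lebesgue_unit_ball_gt0 : (0 < mu B)%E.
Proof.
have M0 : 0 < M by rewrite ltr0n (leq_ltn_trans _ m5).
(* In this cube |x|^2 <= m * m^-2 = 1/m < 1. *)
pose Q := @obox R m (fun=> - M^-1) (fun=> M^-1).
apply: (@lt_le_trans _ _ (mu Q)).
  rewrite lebesgue_obox; last by move=> _; rewrite ge0_cp// invr_ge0 ltW.
  by rewrite lte_fin prodr_gt0// => i _; rewrite opprK addr_gt0// invr_gt0.
apply: le_measure; rewrite ?inE; [exact: measurable_obox|exact: measurable_unit_ball|].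
move=> x Qx; rewrite /unit_ball/= -(@ltr_pXn2r _ 2)// ?nnegrE ?sqrtr_ge0//.
rewrite euclid_sqr expr1n; apply: (@le_lt_trans _ _ (\sum_(i < m) M^-1 ^+ 2)).
  apply: ler_sum => i _; have := Qx i; rewrite in_itv/= -ltr_norml => /ltW xi.
  by rewrite -real_normK ?num_real// lerXn2r ?nnegrE// invr_ge0 ltW.
rewrite sumr_const card_ord (_ : _ *+ m = M^-1); last by rewrite -mulr_natl; field; rewrite gt_eqF.
by rewrite invf_lt1// ltr1n (leq_ltn_trans _ m5).
Qed.

(** Extracts scalar conditions from weak equations: d r^-n vanishes almost everywhere on the ball,
    which has positive measure, while r^-n is nonzero off the origin. *)
Lemma rinv_test_eq0 n (d : R) : (n <= 4)%N ->
  (forall phi, test_function phi ->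
    \int[mu]_(x in B) (d * rinv x ^+ n * phi x) = 0) -> d = 0.
Proof.
move=> n4 H.
have sn : sing n (fun x : 'rV[R]_m => rinv x ^+ n).
  elim: (n) => [|p IHp]; first by under eq_fun do rewrite expr0; exact: sing_cst.
  by under eq_fun do rewrite exprS; exact: (singM (@sing_rinv R m) IHp).
have lg := sing_loc_integrable m5 n4 (singZ d sn).
have H0 := ae_eq0_unit_ball lg H.
apply/eqP; apply: contrapT => /eqP/eqP d0.
have e0 : {ae mu, forall x : 'rV[R]_m, x != 0}.
  exists [set 0]; split; [exact: measurable_set0|exact: lebesgue_origin|].
  by move=> x /= /negP; rewrite negbK => /eqP.
have : mu.-negligible B.
  apply: (@negligibleS _ _ _ _ (~` [set x | (B x -> d * rinv x ^+ n = 0) /\ x != 0])).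
    move=> x Bx [/(_ Bx) /eqP + x0]; apply/negP.
    apply: mulf_neq0; first exact/negP.
    by rewrite expf_neq0// invr_neq0// euclid_eq0.
  by apply: filterS2 H0 e0.
move=> /(negligibleP _ (@measurable_unit_ball R m)) B0.
by have := lebesgue_unit_ball_gt0; rewrite B0 ltxx.
Qed.

Lemma sum_idx (F : idx + unit -> R) : \sum_a F a = \sum_b F (inl b) + F (inr tt).
Proof. by rewrite big_sumType/=; congr (_ + _); rewrite (big_pred1 tt)// => -[]. Qed.

(** * The weak equations for the suspended map *)

Section vtilde.
Variable beta : R.
Let s := sin beta.
Let c := cos beta.
Let lam := 3 * (M + 1).
Let w := @vtilde R m beta.

Lemma sing_vtilde a : sing 0 (w a).
Proof. by case: a => [b|u]; [apply: singZ; exact: sing_vmap|exact: sing_cst]. Qed.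

Lemma partial_vtilde k b x : x != 0 -> partial k (w (inl b)) x = s * partial k (vmap b) x.
Proof. by move=> x0; apply: partialZ; exact: sing_pderivable (sing_vmap b) x0. Qed.

Lemma laplacian_vtilde b x : x != 0 ->
  laplacian (w (inl b)) x = - (s * lam * rinv x ^+ 2 * vmap b x).
Proof.
by move=> x0; rewrite [LHS](laplacianZ s (sing_vmap b) x0) laplacian_vmap// /lam; ring.
Qed.

Let G x := \sum_k \sum_a partial k (w a) x * partial k (w a) x.

Lemma vtilde_grad_sq x : x != 0 -> G x = s ^+ 2 * lam * rinv x ^+ 2.
Proof.
move=> x0; rewrite /G exchange_big/= sum_idx [X in _ + X]big1 ?addr0; last first.
  by move=> k _; rewrite [partial k _ x]partial_cst mul0r.
rewrite (eq_bigr (fun b => s ^+ 2 * grad_dot (vmap b) (vmap b) x)); last first.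
  move=> b _; rewrite /grad_dot mulr_sumr; apply: eq_bigr => k _.
  by rewrite partial_vtilde//; ring.
by rewrite -mulr_sumr sum_grad_vmap// /lam; ring.
Qed.

Lemma represents_grad_sq : represents (grad_sq w) G.
Proof.
apply: represents_sum => k; apply: represents_sum => a.
by apply: representsM; apply: (represents_wpartial m5 k (leq0n 3)); exact: sing_vtilde.
Qed.

Lemma vtilde_sphere x : x != 0 -> \sum_a w a x ^+ 2 = 1.
Proof.
move=> x0; rewrite sum_idx/= (eq_bigr (fun b => s ^+ 2 * vmap b x ^+ 2)); last first.
  by move=> b _; rewrite exprMn.
by rewrite -mulr_sumr sum_vmap_sqr// mulr1 addrC cos2Dsin2.
Qed.

Lemma vtilde_W22_sphere : W22_sphere w.
Proof.
split; first by move=> a; apply: (sing_W22 m5); exact: sing_vtilde.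
exists [set 0]; split; [exact: measurable_set0|exact: lebesgue_origin|].
by move=> x /=; apply: contra_notP => /eqP x0 _; exact: vtilde_sphere.
Qed.

Section testing.
Variable phi : idx + unit -> 'rV[R]_m -> R.
Hypothesis tphi : forall a, test_function (phi a).

Let W x := \sum_a w a x * phi a x.

Let sW : sing 0 W.
Proof.
by apply: sing_sum => a; exact: (singM (sing_vtilde a) (sing_test (tphi a))).
Qed.

Let WE x : W x = s * (\sum_b vmap b x * phi (inl b) x) + c * phi (inr tt) x.
Proof.
rewrite /W sum_idx mulr_sumr; congr (_ + _).
by apply: eq_bigr => b _; rewrite /= mulrA.
Qed.

Let laplacian_W x : x != 0 -> laplacian W x =
  s * (- (lam * rinv x ^+ 2 * \sum_b vmap b x * phi (inl b) x) +
       2 * (\sum_b grad_dot (vmap b) (phi (inl b)) x) +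
       \sum_b vmap b x * laplacian (phi (inl b)) x) +
  c * laplacian (phi (inr tt)) x.
Proof.
move=> x0; have sp a := sing_test (tphi a).
rewrite (laplacian_sum _ (fun a => singM (sing_vtilde a) (sp a)) x0) sum_idx.
congr (_ + _); last exact: (laplacianZ _ (sp _) x0).
rewrite !mulr_sumr -sumrN -!big_split/= mulr_sumr; apply: eq_bigr => b _.
rewrite [LHS](laplacianM (sing_vtilde (inl b)) (sp (inl b)) x0) (laplacian_vtilde _ x0).
have -> : grad_dot (w (inl b)) (phi (inl b)) x = s * grad_dot (vmap b) (phi (inl b)) x.
  by rewrite /grad_dot mulr_sumr; apply: eq_bigr => k _; rewrite partial_vtilde// mulrA.
have -> : w (inl b) x = s * vmap b x by [].
by ring.
Qed.

Let E := lam + 2 * (M - 4) - 2 * s ^+ 2 * lam.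

(** What remains of the integrand once no derivative falls on phi. *)
Definition defect x := lam * s * E * (rinv x ^+ 4 *
  ((1 - s ^+ 2) * (\sum_b vmap b x * phi (inl b) x) - c * s * phi (inr tt) x)).

(** The coefficients are those of the Laplacians of phi in the integrand: -s lam + s^3 lam = lam s
    (s^2 - 1) with q^2 v, and c s^2 lam with q^2. *)
Definition green_part x :=
  lam * s * (s ^+ 2 - 1) * (\sum_b ((rinv x * rinv x * vmap b x) * laplacian (phi (inl b)) x -
    laplacian (fun x => rinv x * rinv x * vmap b x) x * phi (inl b) x)) +
  c * s ^+ 2 * lam * (rinv x * rinv x * laplacian (phi (inr tt)) x -
    laplacian (fun x => rinv x * rinv x) x * phi (inr tt) x).

Definition classical_integrand x :=
  \sum_a laplacian (w a) x * laplacian (phi a) x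
  - 2 * G x * (\sum_k \sum_a partial k (w a) x * partial k (phi a) x)
  + (\sum_a laplacian (w a) x * laplacian (w a) x + 2 * G x ^+ 2) * W x
  + G x * laplacian W x
  - 2 * (\sum_a laplacian (w a) x * laplacian (w a) x) * W x
  - 2 * (\sum_k (\sum_a laplacian (w a) x * partial k (w a) x) * partial k W x).

Lemma represents_biharmonic_integrand :
  represents (biharmonic_integrand w phi) classical_integrand.
Proof.
have rL a : represents (Lap w a) (laplacian (w a)).
  by apply: (represents_wlaplacian m5 (leq0n 2)); exact: sing_vtilde.
have rD k a : represents (Dk k w a) (partial k (w a)).
  by apply: (represents_wpartial m5 k (leq0n 3)); exact: sing_vtilde.
have rc (d : R) : represents (fun _ : 'rV[R]_m => d) (fun=> d).
  by apply: represents_refl; exact: measurable_cst.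
have rs n (f : 'rV[R]_m -> R) : sing n f -> represents f f.
  by move=> sf; apply: represents_refl; exact: sing_measurable_ball sf.
have rG := represents_grad_sq.
have rLL : represents (inner (Lap w) (Lap w)) (fun x => \sum_a laplacian (w a) x * laplacian
  (w a) x).
  by apply: represents_sum => a; exact: representsM.
have rW : represents (inner w phi) W by exact: rs sW.
apply: representsB; last first.
  apply: representsM => //; apply: represents_sum => k; apply: representsM.
    by apply: represents_sum => a; exact: representsM.
  exact: (represents_wpartial m5 k (leq0n 3) sW).
apply: representsB; last by apply: representsM => //; exact: representsM.
apply: representsD; last first.
  by apply: representsM => //; exact: (represents_wlaplacian m5 (leq0n 2) sW).
apply: representsD; last first.
  apply: representsM => //; apply: representsD => //.
  by apply: representsM => //; exact: representsX.
apply: representsB.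
  apply: represents_sum => a; apply: representsM => //.
  exact: (rs _ _ (sing_laplacian_test (tphi a))).
apply: representsM; first exact: representsM.
apply: represents_sum => k; apply: represents_sum => a; apply: representsM => //.
exact: (rs _ _ (sing_test (test_function_partial k (tphi a)))).
Qed.

(** The two terms in grad phi, one explicit and one from the Laplacian of <w, phi>, cancel because
    [G x] multiplies both. The last sum vanishes since Delta w is parallel to (v, 0) and v is
    orthogonal to its derivatives. The two Green terms supply the 2 (m - 4) in E. *)
Lemma classical_integrandE x : x != 0 -> classical_integrand x = defect x + green_part x.
Proof.
move=> x0; rewrite /classical_integrand vtilde_grad_sq//.
have LL : \sum_a laplacian (w a) x * laplacian (w a) x = s ^+ 2 * lam ^+ 2 * rinv x ^+ 4.
  rewrite sum_idx [laplacian (w (inr tt)) x]laplacian_cst mulr0 addr0.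
  rewrite (eq_bigr (fun b => s ^+ 2 * lam ^+ 2 * rinv x ^+ 4 * vmap b x ^+ 2)); last first.
    by move=> b _; rewrite laplacian_vtilde//; ring.
  by rewrite -mulr_sumr sum_vmap_sqr// mulr1.
have LD k : \sum_a laplacian (w a) x * partial k (w a) x = 0.
  rewrite sum_idx [laplacian (w (inr tt)) x]laplacian_cst mul0r addr0.
  rewrite (eq_bigr (fun b => - (s ^+ 2 * lam * rinv x ^+ 2) * (vmap b x * partial k (vmap b) x))).
    by rewrite -mulr_sumr sum_vmap_partial// mulr0.
  by move=> b _; rewrite laplacian_vtilde// partial_vtilde//; ring.
have LP : \sum_a laplacian (w a) x * laplacian (phi a) x =
    - (s * lam * rinv x ^+ 2) * \sum_b vmap b x * laplacian (phi (inl b)) x.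
  rewrite sum_idx [laplacian (w (inr tt)) x]laplacian_cst mul0r addr0 mulr_sumr.
  by apply: eq_bigr => b _; rewrite laplacian_vtilde//; ring.
have DP : \sum_k \sum_a partial k (w a) x * partial k (phi a) x =
    s * \sum_b grad_dot (vmap b) (phi (inl b)) x.
  rewrite exchange_big/= sum_idx [X in _ + X]big1 ?addr0; last first.
    by move=> k _; rewrite [partial k _ x]partial_cst mul0r.
  rewrite mulr_sumr; apply: eq_bigr => b _; rewrite /grad_dot mulr_sumr.
  by apply: eq_bigr => k _; rewrite partial_vtilde// mulrA.
have NP : \sum_b ((rinv x * rinv x * vmap b x) * laplacian (phi (inl b)) x -
    laplacian (fun x => rinv x * rinv x * vmap b x) x * phi (inl b) x) =
    rinv x ^+ 2 * (\sum_b vmap b x * laplacian (phi (inl b)) x) +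
    (lam + 2 * (M - 4)) * rinv x ^+ 4 * \sum_b vmap b x * phi (inl b) x.
  rewrite !mulr_sumr -big_split/=; apply: eq_bigr => b _.
  rewrite (laplacian_rinv2M (sing_vmap b) (grad_dot_rinv_vmap b x0) (laplacian_vmap b x0) x0).
  by rewrite -/lam; ring.
pose X := \sum_b vmap b x * phi (inl b) x.
pose Y := \sum_b vmap b x * laplacian (phi (inl b)) x.
pose Z := \sum_b grad_dot (vmap b) (phi (inl b)) x.
pose q := rinv x; pose p := phi (inr tt) x; pose Lp := laplacian (phi (inr tt)) x.
transitivity (- (s * lam * q ^+ 2) * Y - 2 * (s ^+ 2 * lam * q ^+ 2) * (s * Z)
  + (s ^+ 2 * lam ^+ 2 * q ^+ 4 + 2 * (s ^+ 2 * lam * q ^+ 2) ^+ 2) * (s * X + c * p)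
  + s ^+ 2 * lam * q ^+ 2 * (s * (- (lam * q ^+ 2 * X) + 2 * Z + Y) + c * Lp)
  - 2 * (s ^+ 2 * lam ^+ 2 * q ^+ 4) * (s * X + c * p) - 2 * 0).
  congr (_ - 2 * _ * _ + (_ + _) * _ + _ * _ - 2 * _ * _ - 2 * _).
  - exact: LP.
  - exact: DP.
  - exact: LL.
  - exact: WE.
  - exact: laplacian_W.
  - exact: LL.
  - exact: WE.
  - by apply: big1 => k _; rewrite LD mul0r.
(* A polynomial identity in the scalars X, Y, Z, p, Lp, q, s, c, lam; both occurrences of Z drop
   out. *)
transitivity (lam * s * E * (q ^+ 4 * ((1 - s ^+ 2) * X - c * s * p)) +
  (lam * s * (s ^+ 2 - 1) * (q ^+ 2 * Y + (lam + 2 * (M - 4)) * q ^+ 4 * X) +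
   c * s ^+ 2 * lam * (q * q * Lp - - (2 * (M - 4) * q ^+ 4) * p))).
  by rewrite /E; ring.
congr (_ + (_ * _ + _ * (_ - _ * _))); first exact/esym/NP.
exact/esym/laplacian_rinv2.
Qed.

Lemma sing_defect : sing 4 defect.
Proof.
have s4 : sing 4 (fun x : 'rV[R]_m => rinv x ^+ 4).
  apply: (sing_ext (f := fun x => (rinv x * rinv x) * (rinv x * rinv x))).
    exact: (singM (singM (@sing_rinv R m) (@sing_rinv R m)) (singM (@sing_rinv R m)
      (@sing_rinv R m))).
  by move=> x _; ring.
have s0 : sing 0 (fun x => (1 - s ^+ 2) * (\sum_b vmap b x * phi (inl b) x) - c * s * phi
  (inr tt) x).
  apply: singB; last by apply: singZ; exact: sing_test.
  apply: singZ; apply: sing_sum => b.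
  exact: (singM (sing_vmap b) (sing_test (tphi _))).
exact: (singZ _ (singM s4 s0)).
Qed.

Lemma null_green_part : null green_part.
Proof.
have sr2 := singM (@sing_rinv R m) (@sing_rinv R m).
apply: nullD; apply: nullZ; last exact: null_green.
apply: null_sum => b; apply: null_green => //.
exact: (singM sr2 (sing_vmap b)).
Qed.

Lemma integral_biharmonic_integrand :
  \int[mu]_(x in B) biharmonic_integrand w phi x = \int[mu]_(x in B) defect x.
Proof.
have ng := null_green_part.
have id := sing_integrable m5 (leqnn 4) sing_defect.
rewrite -(Rintegral_null id ng); apply: represents_Rintegral.
apply: (represents_off0 m5 represents_biharmonic_integrand).
  apply: measurable_funD; first exact: sing_measurable_ball sing_defect.
  by case: ng => /measurable_int /measurable_EFinP.
by move=> x _; exact: classical_integrandE.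
Qed.

(** Green's identity with the functions v_b and 1 moves the Laplacian off phi; then Delta v = -lam
    q^2 v combines with |grad w|^2 = s^2 lam q^2. *)
Lemma integral_harmonic_integrand :
  \int[mu]_(x in B) (inner w (fun a => laplacian (phi a)) x + grad_sq w x * inner w phi x) =
  \int[mu]_(x in B) (s * (s ^+ 2 - 1) * lam * (rinv x ^+ 2 * \sum_b vmap b x * phi (inl b) x) +
    c * s ^+ 2 * lam * (rinv x ^+ 2 * phi (inr tt) x)).
Proof.
have sr2 : sing 2 (fun x : 'rV[R]_m => rinv x ^+ 2).
  by apply: (sing_ext (singM (@sing_rinv R m) (@sing_rinv R m))) => x _; rewrite expr2.
have sX : sing 0 (fun x => \sum_b vmap b x * phi (inl b) x).
  by apply: sing_sum => b; exact: (singM (sing_vmap b) (sing_test (tphi _))).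
pose f x := s * (s ^+ 2 - 1) * lam * (rinv x ^+ 2 * \sum_b vmap b x * phi (inl b) x) +
    c * s ^+ 2 * lam * (rinv x ^+ 2 * phi (inr tt) x).
have sf : sing 2 f.
  apply: singD; apply: singZ; first exact: (singM sr2 sX).
  exact: (singM sr2 (sing_test (tphi _))).
pose g x := s * (\sum_b (vmap b x * laplacian (phi (inl b)) x -
    laplacian (vmap b) x * phi (inl b) x)) +
  c * (1 * laplacian (phi (inr tt)) x - laplacian (fun=> 1) x * phi (inr tt) x).
have ng : null g.
  apply: nullD; apply: nullZ.
    apply: null_sum => b; apply: null_green => //.
    exact: (sing_le (leq0n 2) (sing_vmap b)).
  by apply: null_green => //; exact: (sing_le (leq0n 2) (sing_cst 1)).
rewrite -(Rintegral_null (sing_integrable m5 (isT : (2 <= 4)%N) sf) ng).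
apply: represents_Rintegral.
pose h x := \sum_a w a x * laplacian (phi a) x + G x * W x.
have rh : represents (fun x => inner w (fun a => laplacian
  (phi a)) x + grad_sq w x * inner w phi x) h.
  apply: representsD; last first.
    apply: representsM; first exact: represents_grad_sq.
    by apply: represents_refl; exact: sing_measurable_ball sW.
  apply: represents_refl; apply: (@sing_measurable_ball _ _ 0); apply: sing_sum => a.
  exact: (singM (sing_vtilde a) (sing_laplacian_test (tphi a))).
apply: (represents_off0 m5 rh).
  apply: measurable_funD; first exact: sing_measurable_ball sf.
  by case: ng => /measurable_int /measurable_EFinP.
move=> x _ x0; rewrite /h vtilde_grad_sq// WE /f /g laplacian_cst sum_idx.
have -> : \sum_b (vmap b x * laplacian (phi (inl b)) x - laplacian (vmap b) x * phi (inl b) x) =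
  \sum_b vmap b x * laplacian (phi (inl b)) x +
  lam * rinv x ^+ 2 * \sum_b vmap b x * phi (inl b) x.
  rewrite mulr_sumr -big_split/=; apply: eq_bigr => b _.
  by rewrite laplacian_vmap// -/lam; ring.
have -> : \sum_b w (inl b) x * laplacian (phi (inl b)) x =
  s * \sum_b vmap b x * laplacian (phi (inl b)) x.
  by rewrite mulr_sumr; apply: eq_bigr => b _; rewrite /= mulrA.
have -> : w (inr tt) x = c by [].
set X := \sum_b _; set Y := \sum_b _.
ring.
Qed.

End testing.

(** Testing only the constant component removes v from both weak equations and leaves a multiple of
    a power of 1/r. *)
Definition last_test (psi : 'rV[R]_m -> R) (a : idx + unit) : 'rV[R]_m -> R :=
  if a is inr _ then psi else fun=> 0.

Lemma test_last_test psi : test_function psi -> forall a, test_function (last_test psi a).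
Proof. by move=> tpsi [b|u]; [exact: test_function0|]. Qed.

Let sum_last_test psi x : \sum_b vmap b x * last_test psi (inl b) x = 0.
Proof. by rewrite big1// => b _; rewrite mulr0. Qed.

Hypothesis beta_itv : 0 < beta < pi / 2.

Let s0 : s != 0.
Proof. by rewrite gt_eqF// sin_gt0_pihalf. Qed.

Let c0 : c != 0.
Proof.
have /andP[b0 bpi] := beta_itv.
by rewrite gt_eqF// cos_gt0_pihalf// bpi andbT (lt_trans _ b0)// oppr_lt0 (lt_trans b0).
Qed.

Let lam0 : lam != 0.
Proof. by apply: mulf_neq0 => //; rewrite gt_eqF// ltr_wpDl. Qed.

(** The last component is the nonzero constant c, so harmonicity would force c |grad w|^2 = c s^2
    lam / r^2 to vanish. *)
Lemma vtilde_not_weakly_harmonic : ~ weakly_harmonic w.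
Proof.
move=> [_ H]; suff : c * s ^+ 2 * lam = 0.
  by apply/eqP; rewrite !mulf_neq0// expf_neq0.
apply: (@rinv_test_eq0 2) => // psi tpsi.
have := H _ (test_last_test tpsi); rewrite (integral_harmonic_integrand
  (test_last_test tpsi)) => {1}<-.
by apply: eq_Rintegral => x _; rewrite sum_last_test !mulr0 add0r /last_test mulrA.
Qed.

Lemma vtilde_weakly_biharmonicP : weakly_biharmonic w <->
  lam + 2 * (M - 4) - 2 * s ^+ 2 * lam = 0.
Proof.
split=> [[_ H]|E0]; last first.
  split=> [|phi tphi]; first exact: vtilde_W22_sphere.
  rewrite (integral_biharmonic_integrand tphi) /defect E0.
  under eq_Rintegral do rewrite mulr0 mul0r.
  by rewrite /Rintegral integral0.
(* This is the coefficient of psi / r^4 in the defect for the test map [last_test psi]. *)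
set E := LHS; suff : - (lam * s * E * c * s) = 0.
  have gen (a b d e : R) : a != 0 -> b != 0 -> d != 0 -> - (a * b * e * d * b) = 0 -> e = 0.
    move=> a0 b0 d0 /eqP; rewrite oppr_eq0 !mulf_eq0 (negPf a0) (negPf b0) (negPf d0)/=.
    by rewrite !orbF => /eqP.
  exact: gen lam0 s0 c0.
apply: (@rinv_test_eq0 4) => // psi tpsi.
have := H _ (test_last_test tpsi); rewrite (integral_biharmonic_integrand
  (test_last_test tpsi)) => {1}<-.
apply: eq_Rintegral => x _; rewrite /defect sum_last_test /last_test -/E.
by ring.
Qed.

Lemma vtilde_proper_weakly_biharmonicP : proper_weakly_biharmonic w <->
  s ^+ 2 = 5 / 6 * ((M - 1) / (M + 1)).
Proof.
have Mn0 : M + 1 != 0 by rewrite gt_eqF// ltr_wpDl.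
(* Since 3 (m + 1) + 2 (m - 4) = 5 (m - 1) and 2 lam = 6 (m + 1). *)
have E : lam + 2 * (M - 4) - 2 * s ^+ 2 * lam =
    6 * (M + 1) * (5 / 6 * ((M - 1) / (M + 1)) - s ^+ 2).
  by rewrite /lam; field.
split=> [[/vtilde_weakly_biharmonicP + _]|H].
  rewrite E => /eqP; rewrite !mulf_eq0 (negPf Mn0) pnatr_eq0/= subr_eq0 eq_sym.
  by move=> /eqP.
split; last exact: vtilde_not_weakly_harmonic.
by apply/vtilde_weakly_biharmonicP; rewrite E H subrr mulr0.
Qed.

End vtilde.

End biharmonicity.

Theorem theorem1p4 (R : realType) (m : nat) (beta : R) :
  (4 < m)%N -> 0 < beta < pi / 2 ->
  proper_weakly_biharmonic (@vtilde R m beta) <->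
  sin beta ^+ 2 = 5 / 6 * ((m%:R - 1) / (m%:R + 1)).
Proof. by move=> m5 beta_itv; exact: vtilde_proper_weakly_biharmonicP. Qed.
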